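(* Let $K$ be a (large enough) number field with ring of integers $R$. Let $G$ be a finite group and $M$ an abelian subgroup of $G$ of central type. Let $\omega:\widehat{M}\times\widehat{M}\to K^\times$ be a non-degenerate $2$-cocycle and let $\widehat{M}\simeq L\times\widehat{L}$ be a Lagrangian decomposition with respect to which $\omega((l,\lambda),(l',\lambda'))=\lambda(l')$ for all $l,l'\in L$, $\lambda,\lambda'\in\widehat{L}$. Let $J\in KM\otimes KM$ be the twist afforded by $\omega$. Suppose that $L$ (viewed as a subgroup of $M$) is contained in a normal abelian subgroup $N$ of $G$. Assume furthermore that the natural action of $G/N$ on $N$ induced by conjugation is faithful (equivalently, that $C_G(N)=N$). Let $X$ be the Hopf order of $(KG)_J$ over $R$ given by the $R$-subalgebra of $KG$ generated by $\{e^N_\nu g:\nu\in\widehat{N},\,g\in G\}$. Let $Y$ be a Hopf order of $(KG)_J$ over $R$. The following assertions are equivalent: (i) $X=Y$. (ii) $e^N_\nu\in Y$ for all $\nu\in\widehat{N}$. (iii) $e^L_\varepsilon,\ e^N_\varepsilon\in Y$.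
   Context: Hopf orders. Let $H$ be a finite-dimensional Hopf algebra over a field $K$ and $R$ a subring of $K$. A Hopf order of $H$ over $R$ is a finitely generated projective $R$-submodule $X$ of $H$ such that the natural map $X\otimes_R K\to H$ is an isomorphism and $1_H\in X$, $XX\subseteq X$, $\Delta(X)\subseteq X\otimes_R X$ (viewed inside $H\otimes_K H$), $\varepsilon(X)\subseteq R$, $S(X)\subseteq X$, where $\Delta,\varepsilon,S$ are the coproduct, counit and antipode of $H$. ''Large enough'' means that $KM$ and $KN$ split as algebras (are products of copies of $K$). Notation. For a finite abelian group $A$ with $KA$ split, $\widehat{A}$ is the group of characters $A\to K^\times$, $\varepsilon$ is the trivial character, and for $\phi\in\widehat{A}$, $e^A_\phi=\frac{1}{|A|}\sum_{a\in A}\phi(a^{-1})a\in KA$. Twists. The twist afforded by a normalized $2$-cocycle $\omega$ on $\widehat{M}$ is $J=\sum_{\phi,\psi\in\widehat{M}}\omega(\phi,\psi)e^M_\phi\otimes e^M_\psi$. The Hopf algebra $(KG)_J$ equals $KG$ as an algebra, with the same counit, coproduct $\Delta_J(h)=J\Delta(h)J^{-1}$ and antipode $S_J(h)=U_JS(h)U_J^{-1}$, where $U_J=\sum_\phi\omega(\phi,\phi^{-1})e^M_\phi$. Non-degeneracy. $\mathcal{B}_\omega(\phi,\psi)=\omega(\phi,\psi)\omega(\psi,\phi)^{-1}$; $\omega$ is non-degenerate if the pairing $\mathcal{B}_\omega$ is. $M$ is of central type if $M\simeq E\times E$ for some abelian group $E$. Lagrangian decomposition. A subgroup $L\le\widehat{M}$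 is Lagrangian if $L=L^\perp$ with respect to $\mathcal{B}_\omega$; then there is a short exact sequence $1\to L\to\widehat{M}\stackrel{\pi}{\to}\widehat{L}\to1$ with $\pi(m)(l)=\mathcal{B}_\omega(m,l)$. A Lagrangian decomposition is an isomorphism $\widehat{M}\simeq L\times\widehat{L}$ given by a splitting of $\pi$, such that $\mathcal{B}_\omega((l,\lambda),(l',\lambda'))=\lambda(l')\lambda'(l)^{-1}$. Identifying $M$ with the character group of $\widehat{M}$, and $L$ with that of $\widehat{L}$, one gets $M\simeq\widehat{L}\times L$, where the evaluation of $(l,\lambda)\in\widehat{M}$ at $(\lambda',l')\in M$ is $\lambda'(l)\lambda(l')$. In this way $L$ and $\widehat{L}$ are viewed as subgroups of $M$; in particular $e^L_\varepsilon\in KL\subseteq KM$. *)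

(* Defs.v *)
From HB Require Import structures.
From mathcomp Require Import boolp classical_sets.
From mathcomp Require Import all_boot all_order all_algebra all_fingroup.
From mathcomp Require Import all_solvable all_field.

Set Implicit Arguments.
Unset Strict Implicit.
Unset Printing Implicit Defensive.

Import GRing.Theory.
Local Open Scope ring_scope.

(** * Group algebras *)

(* An element x of K[G] is the coefficient function of \sum_g (x g) g.  This
   is an alias of {ffun G -> K} because the latter already carries the
   pointwise product. *)
Definition galg (K : fieldType) (G : finGroupType) : Type := {ffun G -> K^o}.

Section GroupAlgebra.
Variables (K : fieldType) (G : finGroupType).
Local Notation KG := (galg K G).

HB.instance Definition _ := Vector.copy KG {ffun G -> K^o}.

Definition gelt (g : G) : KG := [ffun h => (h == g)%:R].

Definition galg_mul (x y : KG) : KG :=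
  [ffun g => \sum_h x h * y (h^-1 * g)%g].

Fact galg_mulA : associative galg_mul.
Proof.
move=> x y z; apply/ffunP => g; rewrite !ffunE.
under eq_bigr do rewrite ffunE mulr_sumr.
under [RHS]eq_bigr do rewrite ffunE mulr_suml.
rewrite [RHS]exchange_big /=; apply: eq_bigr => h _.
rewrite [RHS](reindex_inj (mulgI h)) /=; apply: eq_bigr => k _.
by rewrite mulKg invMg mulgA mulrA.
Qed.

Fact galg_mul1 : left_id (gelt 1%g) galg_mul.
Proof.
move=> x; apply/ffunP => g; rewrite ffunE (bigD1 1%g) //= big1 => [|h /negbTE].
  by rewrite ffunE eqxx invg1 mul1g mul1r addr0.
by rewrite ffunE => ->; rewrite mul0r.
Qed.

Fact galg_mulr1 : right_id (gelt 1%g) galg_mul.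
Proof.
move=> x; apply/ffunP => g; rewrite ffunE (bigD1 g) //= big1 => [|h hg].
  by rewrite ffunE mulVg eqxx mulr1 addr0.
rewrite ffunE -(inj_eq (mulgI h)) mulKVg mulg1 eq_sym.
by rewrite (negbTE hg) mulr0.
Qed.

Fact galg_mulDl : left_distributive galg_mul +%R.
Proof.
move=> x y z; apply/ffunP => g; rewrite !ffunE -big_split /=.
by apply: eq_bigr => h _; rewrite ffunE mulrDl.
Qed.

Fact galg_mulDr : right_distributive galg_mul +%R.
Proof.
move=> x y z; apply/ffunP => g; rewrite !ffunE -big_split /=.
by apply: eq_bigr => h _; rewrite ffunE mulrDr.
Qed.

Fact galg_1neq0 : gelt 1%g != 0 :> KG.
Proof.
by apply/eqP => /ffunP/(_ 1%g); rewrite !ffunE eqxx; apply/eqP/oner_neq0.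
Qed.

HB.instance Definition _ := GRing.Zmodule_isNzRing.Build KG
  galg_mulA galg_mul1 galg_mulr1 galg_mulDl galg_mulDr galg_1neq0.

Fact galg_scaleAl (a : K) (x y : KG) : a *: (x * y) = (a *: x) * y.
Proof.
apply/ffunP => g; rewrite !ffunE scaler_sumr; apply: eq_bigr => h _.
by rewrite ffunE scalerAl.
Qed.

HB.instance Definition _ := GRing.Lmodule_isLalgebra.Build K KG galg_scaleAl.

Fact galg_scaleAr (a : K) (x y : KG) : a *: (x * y) = x * (a *: y).
Proof.
apply/ffunP => g; rewrite !ffunE scaler_sumr; apply: eq_bigr => h _.
by rewrite ffunE scalerAr.
Qed.

HB.instance Definition _ := GRing.Lalgebra_isAlgebra.Build K KG galg_scaleAr.
HB.instance Definition _ := Algebra_isFalgebra.Build K KG.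

Lemma geltM (g h : G) : gelt g * gelt h = gelt (g * h)%g.
Proof.
apply/ffunP => k; rewrite !ffunE (bigD1 g) //= big1 => [|j /negbTE jg].
  by rewrite !ffunE eqxx mul1r addr0 (can2_eq (mulKVg g) (mulKg g)).
by rewrite ffunE jg mul0r.
Qed.

End GroupAlgebra.

Arguments gelt K {G} g.

Definition split_galg (K : fieldType) (A : finGroupType) : Prop :=
  exists n (f : {lrmorphism galg K A -> {ffun 'I_n -> K^o}}), bijective f.

(** * The group of characters A -> K^* *)

(* Multiplicativity and f 1 = 1 force the values to be nonzero. *)
Definition is_char (K : fieldType) (A : finGroupType) (f : {ffun A -> K}) :=
  (f 1%g == 1) && [forall a, forall b, f (a * b)%g == f a * f b].

Record chars (K : fieldType) (A : finGroupType) : Type :=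
  Chars { char_val :> {ffun A -> K}; _ : is_char char_val }.

Section Characters.
Variables (K : fieldType) (A : finGroupType).
Local Notation hatA := (chars K A).

HB.instance Definition _ := [isSub of hatA for @char_val K A].
HB.instance Definition _ := [Choice of hatA by <:].

Implicit Types (phi psi : hatA) (a b : A).

Lemma char1 phi : phi 1%g = 1.
Proof. by case: phi => f /= /andP[/eqP]. Qed.

Lemma charM phi a b : phi (a * b)%g = phi a * phi b.
Proof. by case: phi => f /= /andP[_ /forallP/(_ a)/forallP/(_ b)/eqP]. Qed.

Lemma charV phi a : phi a^-1%g * phi a = 1.
Proof. by rewrite -charM mulVg char1. Qed.

Lemma charX phi a n : phi (a ^+ n)%g = phi a ^+ n.
Proof. by elim: n => [|n IHn]; rewrite ?char1 // expgS charM IHn exprS. Qed.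

Lemma char_eqP phi psi : (forall a, phi a = psi a) -> phi = psi.
Proof. by move=> eqf; apply/val_inj/ffunP. Qed.

Lemma unity_roots_finite n : (0 < n)%N ->
  exists s : seq K, forall x, x ^+ n = 1 -> x \in s.
Proof.
move=> n_gt0.
pose P m := `[<exists s : seq K,
  [/\ uniq s, all n.-unity_root s & size s = m]>].
have exP : exists m, P m by exists 0%N; apply/asboolP; exists [::].
have leP m : P m -> (m <= n)%N.
  by move=> /asboolP[s [us rs <-]]; apply: max_unity_roots.
case: (ex_maxnP exP leP) => m /asboolP[s [us rs sz]] maxm.
exists s => x xn; apply: contraT => xs.
suff /maxm : P m.+1 by rewrite ltnn.
apply/asboolP; exists (x :: s); split; rewrite /= ?xs ?sz //.
by rewrite rs unity_rootE xn eqxx.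
Qed.

Lemma chars_finite : exists s : seq hatA, forall phi, phi \in s.
Proof.
have [rs rsP] := unity_roots_finite (cardG_gt0 [set: A]).
exists (pmap insub
  [seq [ffun a => val (g a)] | g : {ffun A -> seq_sub rs} in predT]) => phi.
have phiP a : phi a \in rs.
  by rewrite rsP // -charX expg_cardG ?inE // char1.
rewrite mem_pmap; apply/mapP; exists (val phi); last by rewrite valK.
apply/mapP; exists [ffun a => SeqSub (phiP a)]; first by rewrite mem_enum.
by apply/ffunP => a; rewrite !ffunE.
Qed.

Definition chars_enum : seq hatA := undup (projT1 (cid chars_finite)).

Fact chars_enumP : Finite.axiom chars_enum.
Proof.
move=> phi; rewrite count_uniq_mem ?undup_uniq // mem_undup.
by case: (cid _) => s /= ->.
Qed.

Fact chars_pickleK :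
  pcancel (index^~ chars_enum) (fun n => nth None (map some chars_enum) n).
Proof.
move=> phi; have phi_s : phi \in chars_enum.
  by rewrite -has_pred1 has_count chars_enumP.
by rewrite (nth_map phi) ?index_mem // nth_index.
Qed.

HB.instance Definition _ := Choice_isCountable.Build hatA chars_pickleK.
HB.instance Definition _ := isFinite.Build hatA chars_enumP.

Fact one_char_subproof : is_char [ffun _ : A => 1 : K].
Proof.
rewrite /is_char ffunE eqxx; apply/forallP => a; apply/forallP => b.
by rewrite !ffunE mulr1.
Qed.
Definition one_char : hatA := Chars one_char_subproof.

Fact mul_char_subproof phi psi : is_char [ffun a => phi a * psi a].
Proof.
rewrite /is_char ffunE !char1 mulr1 eqxx; apply/forallP => a.
by apply/forallP => b; rewrite !ffunE !charM mulrACA.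
Qed.
Definition mul_char phi psi : hatA := Chars (mul_char_subproof phi psi).

Fact inv_char_subproof phi : is_char [ffun a => (phi a)^-1].
Proof.
rewrite /is_char ffunE char1 invr1 eqxx; apply/forallP => a.
by apply/forallP => b; rewrite !ffunE charM invfM.
Qed.
Definition inv_char phi : hatA := Chars (inv_char_subproof phi).

Fact mul_charA : associative mul_char.
Proof. by move=> f g h; apply: char_eqP => a; rewrite !ffunE mulrA. Qed.

Fact mul_1char : left_id one_char mul_char.
Proof. by move=> f; apply: char_eqP => a; rewrite !ffunE mul1r. Qed.

Fact mul_Vchar : left_inverse one_char inv_char mul_char.
Proof.
move=> f; apply: char_eqP => a; rewrite !ffunE mulVf //.
by apply: contra_eq_neq (charV f a) => ->; rewrite mulr0 eq_sym oner_neq0.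
Qed.

HB.instance Definition _ :=
  Finite_isGroup.Build hatA mul_charA mul_1char mul_Vchar.

End Characters.

(* e^A_phi, with A mapped into G by an embedding i. *)
Definition char_idem (K : fieldType) (A G : finGroupType) (i : A -> G)
    (phi : chars K A) : galg K G :=
  #|A|%:R^-1 *: \sum_(a : A) phi a^-1%g *: gelt K (i a).

(** * Hopf structures on K[G] *)

(* K[G] (x) K[G] is identified with K[G * G], (g, h) standing for g (x) h. *)
Definition tens (K : fieldType) (G : finGroupType) (x y : galg K G) :
  galg K (G * G)%type := [ffun p => x p.1 * y p.2].

Lemma tensM (K : fieldType) (G : finGroupType) (x y x' y' : galg K G) :
  tens x y * tens x' y' = tens (x * x') (y * y').
Proof.
apply/ffunP => -[g h]; rewrite !ffunE /= mulr_suml.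
under [RHS]eq_bigr do rewrite mulr_sumr.
rewrite pair_bigA /=; apply: eq_bigr => -[a b] _ /=.
by rewrite !ffunE /= mulrACA.
Qed.

(* The operations completing the algebra K[G] to a Hopf algebra. *)
Record hopf_ops (K : fieldType) (G : finGroupType) := HopfOps {
  comul : galg K G -> galg K (G * G)%type;
  counit : galg K G -> K;
  antipode : galg K G -> galg K G
}.

Definition group_hopf (K : fieldType) (G : finGroupType) : hopf_ops K G :=
  HopfOps (fun x => \sum_g x g *: tens (gelt K g) (gelt K g))
          (fun x => \sum_g x g)
          (fun x => \sum_g x g *: gelt K g^-1%g).

Section CocycleTwist.
Variables (K : fieldType) (G : finGroupType) (M : {group G}).
Local Notation hatM := (chars K [subg M]).
Variable omega : hatM -> hatM -> K.
Local Notation e := (char_idem (@sgval G M)).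

Definition twist : galg K (G * G)%type :=
  \sum_phi \sum_psi omega phi psi *: tens (e phi) (e psi).

Definition twist_U : galg K G := \sum_phi omega phi phi^-1%g *: e phi.

Definition twisted_hopf : hopf_ops K G :=
  HopfOps (fun x => twist * comul (group_hopf K G) x * twist^-1)
          (counit (group_hopf K G))
          (fun x => twist_U * antipode (group_hopf K G) x * twist_U^-1).

End CocycleTwist.

(** * Hopf orders *)

Section Orders.
Variables (K : fieldType) (R : set K) (G : finGroupType).
Local Notation KG := (galg K G).
Implicit Types X : set KG.

Definition is_submodule X : Prop :=
  [/\ X 0, forall x y, X x -> X y -> X (x + y)
    & forall r x, R r -> X x -> X (r *: x)].

(* X is a direct summand of a free R-module R^n: i : X -> R^n and p : R^n -> X
   are R-linear with p \o i = id. *)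
Definition fg_projective X : Prop :=
  exists n (i : KG -> 'rV[K]_n) (p : 'rV[K]_n -> KG),
    let Rn : set 'rV[K]_n := fun v => forall j, R (v 0 j) in
    [/\ forall x, X x -> Rn (i x),
        forall v, Rn v -> X (p v),
        forall r x y, R r -> X x -> X y -> i (r *: x + y) = r *: i x + i y,
        forall r v w, R r -> Rn v -> Rn w -> p (r *: v + w) = r *: p v + p w
      & forall x, X x -> p (i x) = x].

Definition balanced X (P : zmodType) (b : KG -> K -> P) : Prop :=
  [/\ forall x y k, X x -> X y -> b (x + y) k = b x k + b y k,
      forall x k l, X x -> b x (k + l) = b x k + b x l
    & forall r x k, R r -> X x -> b (r *: x) k = b x (r * k)].

(* The natural map X (x)_R K -> K[G] is an isomorphism, i.e. K[G] together with
   (x, k) |-> k *: x has the universal property of X (x)_R K. *)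
Definition base_change_iso X : Prop :=
  forall (P : zmodType) (b : KG -> K -> P), balanced X b ->
  exists g : {additive KG -> P},
    (forall x k, X x -> g (k *: x) = b x k) /\
    (forall g' : {additive KG -> P},
      (forall x k, X x -> g' (k *: x) = b x k) -> g' =1 g).

(* The image of X (x)_R X in K[G] (x) K[G]. *)
Definition tens_square X : set (galg K (G * G)%type) :=
  fun z => exists n (x y : 'I_n -> KG),
    [/\ forall j, X (x j), forall j, X (y j) & z = \sum_j tens (x j) (y j)].

Definition hopf_order (H : hopf_ops K G) X : Prop :=
  [/\ is_submodule X, fg_projective X & base_change_iso X] /\
  [/\ X 1,
      forall x y, X x -> X y -> X (x * y),
      forall x, X x -> tens_square X (comul H x),
      forall x, X x -> R (counit H x)
    & forall x, X x -> X (antipode H x)].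

Definition is_subalgebra X : Prop :=
  [/\ is_submodule X, X 1 & forall x y, X x -> X y -> X (x * y)].

Definition generated_subalgebra (S : set KG) : set KG :=
  fun x => forall X, is_subalgebra X -> (S `<=` X)%classic -> X x.

(* The R-subalgebra generated by the elements e^N_nu g. *)
Definition idem_order (N : {group G}) : set KG :=
  generated_subalgebra
    (fun x => exists (nu : chars K [subg N]) (g : G),
       x = char_idem sgval nu * gelt K g).

End Orders.

Definition ring_of_integers (K : fieldExtType rat) : set K :=
  integralOver (intr : int -> K).

(** * Cocycles and Lagrangian decompositions *)

(* D is the character group of M in the application. *)
Section Cocycles.
Variables (K : fieldType) (D : finGroupType) (omega : D -> D -> K).

Definition normalized_2cocycle : Prop :=
  [/\ forall x y, omega x y != 0,
      forall x y z, omega x y * omega (x * y)%g z =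
                    omega y z * omega x (y * z)%g
    & forall x, omega 1%g x = 1 /\ omega x 1%g = 1].

Definition cocycle_pairing (x y : D) : K := omega x y * (omega y x)^-1.

Definition nondegenerate_cocycle : Prop :=
  forall x, (forall y, cocycle_pairing x y = 1) -> x = 1%g.

Definition lagrangian_subgroup (L : {group D}) : Prop :=
  forall x, x \in L <-> (forall l, l \in L -> cocycle_pairing x l = 1).

(* s is a splitting of pi : D -> hat L, pi m l = cocycle_pairing m l; the
   resulting isomorphism L * hat L -> D is (l, lam) |-> l * s lam. *)
Definition lagr_pt (L : {group D}) (s : chars K [subg L] -> D)
    (l : [subg L]) (lam : chars K [subg L]) : D := (sgval l * s lam)%g.

Definition lagrangian_decomposition (L : {group D})
    (s : chars K [subg L] -> D) : Prop :=
  [/\ lagrangian_subgroup L,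
      {morph s : lam mu / (lam * mu)%g},
      forall lam l, cocycle_pairing (s lam) (sgval l) = lam l
    & forall l l' lam lam',
        cocycle_pairing (lagr_pt s l lam) (lagr_pt s l' lam') =
        lam l' * (lam' l)^-1].

End Cocycles.

Definition central_type (G : finGroupType) (M : {group G}) : Prop :=
  exists (eT : finGroupType) (E : {group eT}),
    abelian E /\ M \isog setX E E.

Section LagrangianInM.
Variables (K : fieldType) (A : finGroupType) (L : {group chars K A}).
Variable s : chars K [subg L] -> chars K A.

(* The element of A corresponding to (lam', l') under the identification of A
   with hat L * L: the evaluation of (l, lam) at it is lam' l * lam l'.  When
   K[A] is split and s is a Lagrangian decomposition there is exactly one such
   element, so that the default value 1 is never used. *)
Definition lagr_dual_pt (lam' : chars K [subg L]) (l' : [subg L]) : A :=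
  odflt 1%g [pick a | [forall l, forall lam,
    (lagr_pt s l lam : chars K A) a == lam' l * lam l']].

Definition lagr_emb (l' : [subg L]) : A := lagr_dual_pt 1%g l'.

End LagrangianInM.

(* Main.v *)
(** Let e_nu = e^N_nu and let tau nu in M be the element of the dual of L given
    by the restriction of nu to L.  Then J (e_nu (x) x) = e_nu (x) (tau nu) x,
    so that the coproduct of e_nu g is a sum of tensors of elements of this form.

    If e_1 lies in Y, its coproduct \sum_nu e_nu (x) e_(nu'), with nu |-> nu' a
    bijection, lies in Y (x) Y.  Evaluating a coordinate function u of Y on the
    first factor yields an element of Y whose eigenvalues are the u(e_nu); they
    are integral, hence all e_nu lie in Y.

    If all e_nu lie in Y, the antipode shows that the matrix coefficients of the
    permutation representation of G on the characters of N are integral on Y.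
    As G / N acts faithfully, Y is therefore the direct sum of submodules
    I(nu, g) e_nu g with I(nu, g) an R-submodule of K.  The coproduct, the
    product and the antipode of Y relate the I(nu, g): they are superadditive
    along one composition law and subadditive along the other, and averaging
    over G and over the finite group of characters forces I(nu, g) = R, that is
    Y = X. *)

From HB Require Import structures.
Require Import Defs.
From mathcomp Require Import boolp classical_sets.
From mathcomp Require Import all_boot all_order all_algebra all_fingroup.
From mathcomp Require Import all_solvable all_field.
From mathcomp Require Import ring.

Set Implicit Arguments.
Unset Strict Implicit.
Unset Printing Implicit Defensive.

Import GRing.Theory.
Local Open Scope ring_scope.

(** * Characters of finite groups and their orthogonality *)

Lemma natr_fieldExt_eq0 (K : fieldExtType rat) n :
  (n%:R == 0 :> K) = (n == 0)%N.
Proof.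
by rewrite -(rmorph_nat (in_alg K)) fmorph_eq0 Num.Theory.pnatr_eq0.
Qed.

Section CharacterTheory.
Variables (K : fieldExtType rat) (A : finGroupType).
Implicit Types (phi psi : chars K A) (a b : A).

Lemma char_neq0 phi a : phi a != 0.
Proof.
by apply: contra_eq_neq (charV phi a) => ->; rewrite mulr0 eq_sym oner_neq0.
Qed.

Lemma charVE phi a : phi a^-1%g = (phi a)^-1.
Proof.
by apply: (mulIf (char_neq0 phi a)); rewrite charV mulVf ?char_neq0.
Qed.

Lemma mul_charE phi psi a : (phi * psi)%g a = phi a * psi a.
Proof. by rewrite ffunE. Qed.

Lemma one_charE a : (1%g : chars K A) a = 1.
Proof. by rewrite ffunE. Qed.

Lemma inv_charE phi a : (phi^-1)%g a = (phi a)^-1.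
Proof. by rewrite ffunE. Qed.

Lemma char_mulC phi psi : (phi * psi = psi * phi)%g.
Proof. by apply: char_eqP => a; rewrite !mul_charE mulrC. Qed.

Lemma sum_char phi : \sum_a phi a = (phi == 1%g)%:R * #|A|%:R.
Proof.
have [->|phi1] := eqVneq phi 1%g.
  by under eq_bigr do rewrite one_charE; rewrite sumr_const mul1r.
have [b phib] : exists b, phi b != 1.
  apply/existsP; apply: contraNT phi1 => /existsPn phiE.
  apply/eqP/char_eqP => a; rewrite one_charE.
  exact/eqP/negbNE/phiE.
have phib1 : phi b - 1 != 0 by rewrite subr_eq0.
rewrite mul0r; apply: (mulfI phib1); rewrite mulr0 mulrBl mul1r.
apply/eqP; rewrite subr_eq0 mulr_sumr [eqbRHS](reindex_inj (mulgI b)) /=.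
by apply/eqP/eq_bigr => a _; rewrite Defs.charM.
Qed.

Lemma sum_char_mulV phi psi :
  \sum_a phi a * psi a^-1%g = (phi == psi)%:R * #|A|%:R.
Proof.
rewrite eq_mulgV1 -sum_char; apply: eq_bigr => a _.
by rewrite mul_charE inv_charE charVE.
Qed.

Lemma card_neq0 : #|A|%:R != 0 :> K.
Proof.
by rewrite natr_fieldExt_eq0 -lt0n -cardsT (cardG_gt0 [set: A]).
Qed.

Lemma char_bidual (Phi : chars K A -> K) :
  Phi 1%g = 1 -> (forall phi psi, Phi (phi * psi)%g = Phi phi * Phi psi) ->
  exists a, forall phi, phi a = Phi phi.
Proof.
move=> Phi1 PhiM.
pose u a := \sum_phi Phi phi * phi a^-1%g.
(* If u a != 0, then translating the sum by phi shows Phi phi = phi a. *)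
have [a ua] : exists a, u a != 0.
  apply/existsP; apply: contraNT card_neq0 => /existsPn u0.
  (* Summed over [a], only the trivial character survives, so not all [u a] can vanish. *)
  have -> : #|A|%:R = \sum_a u a :> K.
    rewrite /u exchange_big (bigD1 1%g) //= [X in _ + X]big1 ?addr0.
      under eq_bigr do rewrite Phi1 one_charE mul1r.
      by rewrite sumr_const.
    move=> phi phi1; rewrite -mulr_sumr (reindex_inj invg_inj) /=.
    under eq_bigr do rewrite invgK.
    by rewrite sum_char (negbTE phi1) mul0r mulr0.
  by rewrite big1 // => a _; apply/eqP/negbNE/u0.
exists a => phi.
have /eqP : u a = Phi phi * phi a^-1%g * u a.
  rewrite {1}/u (reindex_inj (mulgI phi)) mulr_sumr /=.
  by apply: eq_bigr => psi _; rewrite PhiM mul_charE mulrACA.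
rewrite -subr_eq0 -{1}[u a]mul1r -mulrBl mulf_eq0 (negbTE ua) orbF subr_eq0.
rewrite charVE => /eqP phiE.
by rewrite -[RHS](mulfVK (char_neq0 phi a)) -phiE mul1r.
Qed.

Section Split.
Hypothesis splitA : split_galg K A.

(** The coordinates of the splitting isomorphism restrict to characters; if all of them are 1 at
    [a], injectivity identifies the group elements [a] and 1. *)
Lemma char_separates a : (forall phi : chars K A, phi a = 1) -> a = 1%g.
Proof.
case: splitA => n [f [g fK _]] phia.
have phiP i : is_char [ffun b => f (gelt K b) i].
  apply/andP; split; first by rewrite ffunE rmorph1 ffunE.
  apply/forallP => b; apply/forallP => c.
  by rewrite !ffunE -geltM rmorphM ffunE.
have /(can_inj fK)/ffunP/(_ a) : f (gelt K a) = f (gelt K 1%g).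
  apply/ffunP => i; have := phia (Chars (phiP i)); rewrite ffunE => ->.
  by rewrite rmorph1 ffunE.
by rewrite !ffunE eqxx; case: eqP => // _ /eqP; rewrite oner_eq0.
Qed.

Lemma char_separate a b : (forall phi : chars K A, phi a = phi b) -> a = b.
Proof.
move=> ab; apply/eqP; rewrite eq_mulgV1; apply/eqP/char_separates => phi.
by rewrite Defs.charM charVE ab mulfV ?char_neq0.
Qed.

Lemma sum_chars a : \sum_(phi : chars K A) phi a = (a == 1%g)%:R * #|A|%:R.
Proof.
have sum0 b : b != 1%g -> \sum_(phi : chars K A) phi b = 0.
  move=> b1; have [phi phib] : exists phi : chars K A, phi b != 1.
    apply/existsP; apply: contraNT b1 => /existsPn phiE.
    by apply/eqP/char_separates => phi; apply/eqP/negbNE.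
  have phib1 : phi b - 1 != 0 by rewrite subr_eq0.
  apply: (mulfI phib1); rewrite mulr0 mulrBl mul1r.
  apply/eqP; rewrite subr_eq0 mulr_sumr [eqbRHS](reindex_inj (mulgI phi)) /=.
  by apply/eqP/eq_bigr => psi _; rewrite mul_charE.
have [->|/sum0->] := eqVneq a 1%g; last by rewrite mul0r.
(* The characters are counted by adding the vanishing sums at [b != 1] and exchanging the order of
   summation. *)
rewrite mul1r; transitivity (\sum_b \sum_(phi : chars K A) phi b).
  by rewrite [RHS](bigD1 1%g) //= [X in _ + X]big1 ?addr0.
rewrite exchange_big (bigD1 1%g) //= [X in _ + X]big1.
  by under eq_bigr do rewrite ffunE; rewrite sumr_const addr0.
by move=> phi /negbTE phi1; rewrite sum_char phi1 mul0r.
Qed.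

End Split.
End CharacterTheory.

(** * Elements of K[G] and bilinear maps on its tensor square *)

Section GroupAlgebraTheory.
Variables (K : fieldType) (G : finGroupType).
Local Notation KG := (galg K G).
Implicit Types (x y : KG) (g h : G).

Lemma galgZE (H : finGroupType) a (x : galg K H) (g : H) :
  (a *: x) g = a * x g.
Proof. by rewrite ffunE. Qed.

Lemma gelt1 : gelt K (1%g : G) = 1. Proof. by []. Qed.

Lemma galgE x : x = \sum_g x g *: gelt K g.
Proof.
apply/ffunP => h; rewrite sum_ffunE (bigD1 h) //= big1 => [|g /negbTE gh].
  by rewrite !ffunE eqxx addr0 -[RHS]/(_ * _) mulr1.
by rewrite !ffunE eq_sym gh -[LHS]/(_ * _) mulr0.
Qed.

Definition galg_restr (P : pred G) x : KG := [ffun g => if P g then x g else 0].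

Lemma galg_restrE (P : pred G) x :
  galg_restr P x = \sum_(g | P g) x g *: gelt K g.
Proof.
rewrite {1}(galgE (galg_restr P x)) [RHS]big_mkcond; apply: eq_bigr => g _.
by rewrite ffunE; case: (P g); rewrite ?scale0r.
Qed.

Lemma mul_geltE g x h : (x * gelt K g) h = x (h * g^-1)%g.
Proof.
rewrite ffunE (bigD1 (h * g^-1)%g) //= big1 => [|k kg].
  by rewrite ffunE invMg invgK mulgKV eqxx mulr1 addr0.
rewrite ffunE; case: eqP => [kh|]; last by rewrite mulr0.
by case/eqP: kg; rewrite -kh invMg invgK mulKVg.
Qed.

Lemma geltV g : gelt K g * gelt K g^-1%g = 1.
Proof. by rewrite geltM mulgV. Qed.

Lemma tensE x y g h : tens x y (g, h) = x g * y h.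
Proof. by rewrite ffunE. Qed.

Lemma tens_sumr (I : finType) (P : pred I) x (y : I -> KG) :
  tens x (\sum_(i | P i) y i) = \sum_(i | P i) tens x (y i).
Proof.
apply/ffunP => -[g h]; rewrite sum_ffunE ffunE /= sum_ffunE mulr_sumr.
by apply: eq_bigr => i _; rewrite ffunE.
Qed.

Lemma tens_suml (I : finType) (P : pred I) (x : I -> KG) y :
  tens (\sum_(i | P i) x i) y = \sum_(i | P i) tens (x i) y.
Proof.
apply/ffunP => -[g h]; rewrite sum_ffunE ffunE /= sum_ffunE mulr_suml.
by apply: eq_bigr => i _; rewrite ffunE.
Qed.

Lemma tensZl a x y : tens (a *: x) y = a *: tens x y.
Proof. by apply/ffunP => -[g h]; rewrite galgZE !ffunE mulrA. Qed.

Lemma tensZr a x y : tens x (a *: y) = a *: tens x y.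
Proof. by apply/ffunP => -[g h]; rewrite galgZE !ffunE mulrCA. Qed.

Lemma tens11 : tens (1 : KG) (1 : KG) = 1.
Proof.
apply/ffunP => -[g h]; rewrite !ffunE /= -natrM mulnb.
by congr (nat_of_bool _)%:R.
Qed.

(** The universal property of the tensor square in the model K[G * G]; through it bilinear maps are
    applied to coproducts. *)
Lemma tens_lift (V : lmodType K) (B : KG -> KG -> V) :
  (forall y, linear (B^~ y)) -> (forall x, linear (B x)) ->
  exists f : {linear galg K (G * G)%type -> V},
    forall x y, f (tens x y) = B x y.
Proof.
move=> Bl Br.
pose f (z : galg K (G * G)%type) :=
  \sum_p z p *: B (gelt K p.1) (gelt K p.2).
have f_lin : linear f.
  move=> a u v; rewrite /f scaler_sumr -big_split /=; apply: eq_bigr => p _.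
  by rewrite !ffunE scalerA -scalerDl.
pose fL := GRing.isLinear.Build _ _ _ _ f f_lin.
pose F : {linear _ -> _} := HB.pack f fL.
exists F => x y; rewrite /= /f.
pose Bx z : {linear _ -> _} :=
  HB.pack (B z) (GRing.isLinear.Build _ _ _ _ (B z) (Br z)).
pose By z : {linear _ -> _} :=
  HB.pack (B^~ z) (GRing.isLinear.Build _ _ _ _ (B^~ z) (Bl z)).
rewrite [in RHS](galgE x) -[RHS]/(By y _) linear_sum /=.
transitivity (\sum_g \sum_h (x g * y h) *: B (gelt K g) (gelt K h)).
  by rewrite pair_bigA /=; apply: eq_bigr => -[g h] _; rewrite tensE.
apply: eq_bigr => g _; rewrite -[RHS]/(By y _) linearZ /= [in RHS](galgE y).
rewrite -[B _ (\sum_h _)]/(Bx _ _) linear_sum scaler_sumr /=.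
by apply: eq_bigr => h _; rewrite -[B _ (_ *: _)]/(Bx _ _) linearZ /= scalerA.
Qed.

End GroupAlgebraTheory.

(** * Idempotents attached to characters *)

Section CharacterIdempotents.
Variables (K : fieldExtType rat) (A G : finGroupType) (i : A -> G).
Hypothesis iM : {morph i : a b / (a * b)%g}.
Implicit Types (phi psi : chars K A) (a b : A).
Local Notation e := (char_idem i).

Lemma char_idem_geltl phi a : gelt K (i a) * e phi = phi a *: e phi.
Proof.
rewrite -scalerAr scalerA mulrC -scalerA; congr (_ *: _).
rewrite mulr_sumr scaler_sumr (reindex_inj (mulgI a^-1%g)) /=.
apply: eq_bigr => b _; rewrite -scalerAr geltM -iM mulKVg scalerA.
by rewrite invMg invgK Defs.charM mulrC.
Qed.

Lemma char_idem_geltr phi a : e phi * gelt K (i a) = phi a *: e phi.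
Proof.
rewrite -scalerAl scalerA mulrC -scalerA; congr (_ *: _).
rewrite mulr_suml scaler_sumr (reindex_inj (mulIg a^-1%g)) /=.
apply: eq_bigr => b _; rewrite -scalerAl geltM -iM mulgKV scalerA.
by rewrite invMg invgK Defs.charM.
Qed.

Lemma char_idemM phi psi : e phi * e psi = (phi == psi)%:R *: e phi.
Proof.
rewrite {2}/char_idem -scalerAr mulr_sumr.
under eq_bigr do rewrite -scalerAr char_idem_geltr scalerA mulrC.
rewrite -scaler_suml sum_char_mulV scalerA mulrCA mulVf ?mulr1 //.
exact: card_neq0.
Qed.

Lemma char_idem_id phi : e phi * e phi = e phi.
Proof. by rewrite char_idemM eqxx scale1r. Qed.

Lemma gelt_char_idem (splitA : split_galg K A) a :
  gelt K (i a) = \sum_(phi : chars K A) phi a *: e phi.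
Proof.
rewrite /char_idem.
under eq_bigr do rewrite scalerA mulrC -scalerA scaler_sumr.
rewrite -scaler_sumr exchange_big /=.
under eq_bigr => b _.
  under eq_bigr do rewrite scalerA -Defs.charM.
  rewrite -scaler_suml (sum_chars splitA) -eq_mulgV1.
  over.
rewrite (bigD1 a) //= [X in _ + X]big1 => [|b]; last first.
  by rewrite eq_sym => /negbTE->; rewrite mul0r scale0r.
by rewrite eqxx mul1r addr0 scalerA mulVf ?scale1r // card_neq0.
Qed.

Lemma sum_char_idem (splitA : split_galg K A) :
  \sum_(phi : chars K A) e phi = 1.
Proof.
have i1 : i 1%g = 1%g by apply: (mulgI (i 1%g)); rewrite -iM !mulg1.
rewrite -gelt1 -i1 (gelt_char_idem splitA).
by apply: eq_bigr => phi _; rewrite Defs.char1 scale1r.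
Qed.

End CharacterIdempotents.

(** * Integrality and dual bases of orders *)

Section RingOfIntegers.
Variable K : fieldExtType rat.
Local Notation R := (@ring_of_integers K).

Lemma ring_of_integers0 : R 0. Proof. exact: integral0. Qed.

Lemma ring_of_integers1 : R 1. Proof. exact: integral1. Qed.

Lemma ring_of_integersD a b : R a -> R b -> R (a + b).
Proof. exact: integral_add. Qed.

Lemma ring_of_integersB a b : R a -> R b -> R (a - b).
Proof. exact: integral_sub. Qed.

Lemma ring_of_integersM a b : R a -> R b -> R (a * b).
Proof. exact: integral_mul. Qed.

Lemma ring_of_integers_sum (I : finType) (P : pred I) (F : I -> K) :
  (forall i, P i -> R (F i)) -> R (\sum_(i | P i) F i).
Proof.
move=> RF; elim/big_ind: _ => //; first exact: ring_of_integers0.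
exact: ring_of_integersD.
Qed.

Lemma ring_of_integers_prod (I : finType) (P : pred I) (F : I -> K) :
  (forall i, P i -> R (F i)) -> R (\prod_(i | P i) F i).
Proof.
move=> RF; elim/big_ind: _ => //; first exact: ring_of_integers1.
exact: ring_of_integersM.
Qed.

Lemma ring_of_integers_root (p : {poly K}) a :
  p \is monic -> root p a -> (forall i, R p`_i) -> R a.
Proof.
by move=> p_monic pa /integral_poly; apply: integral_root_monic.
Qed.

Lemma ring_of_integers_expr n a : (0 < n)%N -> R (a ^+ n) -> R a.
Proof.
move=> n_gt0 Ran; apply: (@ring_of_integers_root ('X^n - (a ^+ n)%:P)).
- exact: monicXnsubC.
- by rewrite rootE !hornerE subrr.
move=> i; rewrite coefB coefXn coefC; apply: ring_of_integersB.
  by case: eqP => _; [apply: ring_of_integers1 | apply: ring_of_integers0].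
by case: eqP => _ //; apply: ring_of_integers0.
Qed.

Definition has_integral_coefs (p : {poly K}) := forall i, R p`_i.

Lemma char_poly_integral n (t : 'M[K]_n) :
  (forall i j, R (t i j)) -> has_integral_coefs (char_poly t).
Proof.
move=> Rt.
have R1 : has_integral_coefs 1.
  move=> i; rewrite coef1.
  by case: eqP => _; [apply: ring_of_integers1 | apply: ring_of_integers0].
have RM p q : has_integral_coefs p -> has_integral_coefs q ->
  has_integral_coefs (p * q).
  move=> Rp Rq i; rewrite coefM; apply: ring_of_integers_sum => j _.
  exact: ring_of_integersM.
(* The determinant is expanded into signed products of entries of the characteristic matrix. *)
apply: (big_ind has_integral_coefs) => [i|p q Rp Rq i|s _].
- by rewrite coef0; apply: ring_of_integers0.
- by rewrite coefD; apply: ring_of_integersD.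
apply: (RM) => [|]; first last.
  apply: (big_ind has_integral_coefs) => // i _ k.
  rewrite !mxE coefB coefMn coefX coefC.
  apply: ring_of_integersB; last by case: eqP => _ //; apply: ring_of_integers0.
  by rewrite -mulrnA; apply: integral_nat.
elim: (odd_perm s) => //=; rewrite expr1 => i; rewrite coefN -sub0r.
by apply: ring_of_integersB => //; apply: ring_of_integers0.
Qed.

Lemma eigenvalue_integral n (t : 'M[K]_n) (v : 'I_n -> K) d :
  (forall i j, R (t i j)) -> (exists j, v j != 0) ->
  (forall k, d * v k = \sum_j t k j * v j) -> R d.
Proof.
(* [eigenvalueP] works with row eigenvectors, hence the transpose. *)
move=> Rt [j0 vj0] dv; apply: (@ring_of_integers_root (char_poly t^T)).
- exact: char_poly_monic.
- rewrite -eigenvalue_root_char; apply/eigenvalueP.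
  exists (\row_j v j).
    apply/rowP => k; rewrite !mxE dv; apply: eq_bigr => j _.
    by rewrite !mxE mulrC.
  by apply: contraNneq vj0 => /rowP/(_ j0); rewrite !mxE => ->.
by apply: char_poly_integral => i j; rewrite mxE.
Qed.

End RingOfIntegers.

Section OrderTheory.
Variables (K : fieldExtType rat) (G : finGroupType).
Local Notation R := (@ring_of_integers K).
Local Notation KG := (galg K G).
Variable Y : set KG.
Hypotheses (Ysub : is_submodule R Y) (Yproj : fg_projective R Y).
Hypothesis (Ybase : base_change_iso R Y).

Lemma submodule_sum (I : finType) (P : pred I) (F : I -> KG) :
  (forall i, P i -> Y (F i)) -> Y (\sum_(i | P i) F i).
Proof. by case: Ysub => Y0 YD YZ YF; elim/big_ind: _. Qed.

Lemma base_change_eq (P : zmodType) (f g : {additive KG -> P}) :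
  (forall x k, Y x -> f (k *: x) = g (k *: x)) -> f =1 g.
Proof.
case: Ysub => _ YD YZ fg.
have [|h [_ h_uniq]] := Ybase (b := fun x k => g (k *: x)).
  by split=> *; rewrite ?scalerDr ?scalerDl ?raddfD // scalerA mulrC.
by move=> x; rewrite (h_uniq f) // (h_uniq g).
Qed.

(** The universal property for [b x k = k * u x] gives an additive extension. It is K-linear by
    uniqueness, since [f (a *: x)] and [a * f x] agree on all multiples of elements of Y. *)
Lemma base_change_functional (u : KG -> K) :
  (forall r x y, R r -> Y x -> Y y -> u (r *: x + y) = r * u x + u y) ->
  exists f : {linear KG -> K^o}, forall x, Y x -> f x = u x.
Proof.
case: Ysub => Y0 YD YZ u_lin.
have uD x y : Y x -> Y y -> u (x + y) = u x + u y.
  move=> Yx Yy; rewrite -[x in LHS]scale1r u_lin ?mul1r //.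
  exact: ring_of_integers1.
have u0 : u 0 = 0.
  by apply: (addrI (u 0)); rewrite -uD // !addr0.
have uZ r x : R r -> Y x -> u (r *: x) = r * u x.
  by move=> Rr Yx; rewrite -[_ *: _]addr0 u_lin // u0 addr0.
have [|f [fE _]] := Ybase (P := K) (b := fun x k => k * u x).
  split=> [x y k Yx Yy|x k l Yx|r x k Rr Yx].
  - by rewrite uD // mulrDr.
  - by rewrite mulrDl.
  by rewrite uZ // mulrCA mulrA.
have fZ a x : f (a *: x) = a * f x.
  have add1 : zmod_morphism (fun x : KG => f (a *: x)).
    by move=> y z /=; rewrite scalerBr raddfB.
  have add2 : zmod_morphism (fun x : KG => a * f x).
    by move=> y z /=; rewrite raddfB mulrBr.
  pose f1 : {additive KG -> K} := HB.pack (fun x : KG => f (a *: x))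
    (GRing.isZmodMorphism.Build _ _ _ add1).
  pose f2 : {additive KG -> K} := HB.pack (fun x : KG => a * f x)
    (GRing.isZmodMorphism.Build _ _ _ add2).
  apply: (base_change_eq (f := f1) (g := f2)) => y k Yy /=.
  by rewrite scalerA !fE // mulrA.
have f_lin : linear (f : KG -> K^o).
  by move=> a x y; rewrite raddfD /= fZ.
pose F : {linear KG -> K^o} := HB.pack (f : KG -> K^o)
  (GRing.isLinear.Build _ _ _ _ (f : KG -> K^o) f_lin).
by exists F => x Yx /=; rewrite -[x]scale1r fE // mul1r scale1r.
Qed.

(* The coordinates of a projective basis, extended K-linearly: membership in Y
   can be tested on them. *)
Lemma dual_basis : exists n (u : 'I_n -> {linear KG -> K^o}) (p : 'I_n -> KG),
  [/\ forall j, Y (p j), forall j x, Y x -> R (u j x)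
    & forall x, x = \sum_j u j x *: p j].
Proof.
case: Yproj => n [i [p [iY pY i_lin p_lin piK]]]; case: (Ysub) => Y0 YD YZ.
have /choice[u uE] j : exists f : {linear KG -> K^o},
    forall x, Y x -> f x = i x 0 j.
  apply: (@base_change_functional (fun x => i x 0 j)) => r x y Rr Yx Yy.
  by rewrite i_lin // !mxE.
have Rdelta j k : R ((delta_mx 0 j : 'rV[K]_n) 0 k).
  rewrite mxE; case: (_ && _); last exact: ring_of_integers0.
  exact: ring_of_integers1.
have R0 k : R ((0 : 'rV[K]_n) 0 k) by rewrite mxE; apply: ring_of_integers0.
have pD (v w : 'rV[K]_n) : (forall j, R (v 0 j)) -> (forall j, R (w 0 j)) ->
    p (v + w) = p v + p w.
  move=> Rv Rw; rewrite -[v in LHS]scale1r p_lin ?scale1r //.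
  exact: ring_of_integers1.
have p0 : p 0 = 0 by apply: (addrI (p 0)); rewrite -pD // !addr0.
have pZ r (v : 'rV[K]_n) :
    R r -> (forall j, R (v 0 j)) -> p (r *: v) = r *: p v.
  by move=> Rr Rv; rewrite -[_ *: _]addr0 p_lin // p0 addr0.
(* [p] is linear only on vectors over R, so the integrality of the partial sums is carried through
   the same induction. *)
have p_sum (J : seq 'I_n) (c : 'I_n -> K) : (forall j, R (c j)) ->
    p (\sum_(j <- J) c j *: delta_mx 0 j) =
      \sum_(j <- J) c j *: p (delta_mx 0 j) /\
    forall k, R ((\sum_(j <- J) c j *: delta_mx 0 j : 'rV[K]_n) 0 k).
  move=> Rc; elim: J => [|j J [IHp IHR]]; first by rewrite !big_nil.
  have Rcj k : R ((c j *: delta_mx 0 j : 'rV[K]_n) 0 k).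
    by rewrite mxE; apply: ring_of_integersM.
  rewrite !big_cons pD // IHp pZ //; split=> // k.
  by rewrite mxE; apply: ring_of_integersD.
exists n, u, (fun j => p (delta_mx 0 j)); split.
- by move=> j; apply: pY => k; apply: Rdelta.
- by move=> j x Yx; rewrite uE //; apply: iY.
have additive_rhs : zmod_morphism (fun x => \sum_j u j x *: p (delta_mx 0 j)).
  by move=> x y; rewrite -sumrB; apply: eq_bigr => j _; rewrite raddfB scalerBl.
pose f2 : {additive KG -> KG} := HB.pack
  (fun x => \sum_j u j x *: p (delta_mx 0 j))
  (GRing.isZmodMorphism.Build _ _ _ additive_rhs).
have idE : (idfun : {additive KG -> KG}) =1 f2.
  apply: base_change_eq => x k Yx /=.
  under eq_bigr do rewrite linearZ /= -scalerA uE //.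
  rewrite -scaler_sumr; congr (_ *: _).
  rewrite -{1}[x]piK // {1}[i x]row_sum_delta.
  exact: (p_sum (index_enum _) (i x 0) (iY x Yx)).1.
by move=> x; apply: (idE x).
Qed.

(* On the generators p j of Y, multiplication by d is a matrix over R with the
   eigenvector f (p j). *)
Lemma order_integral (f : {linear KG -> K^o}) d :
  (exists x, f x != 0) ->
  (forall y, Y y -> exists2 y', Y y' & f y' = d * f y) -> R d.
Proof.
move=> [x fx] fd; have [n [u [p [Yp Ru pE]]]] := dual_basis.
have /choice[y yP] j : exists y, Y y /\ f y = d * f (p j).
  by have [y] := fd _ (Yp j); exists y.
apply: (@eigenvalue_integral _ _ (\matrix_(k, j) u j (y k)) (fun j => f (p j))).
- by move=> k j; rewrite mxE; apply/Ru/(yP k).1.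
- apply/existsP; apply: contraNT fx => /existsPn f0.
  rewrite (pE x) linear_sum big1 // => j _; rewrite linearZ /=.
  by have /negbNE/eqP-> := f0 j; rewrite scaler0.
move=> k; have [_ <-] := yP k; rewrite {1}(pE (y k)) linear_sum.
by apply: eq_bigr => j _; rewrite linearZ mxE.
Qed.

End OrderTheory.

(** * Twists from Lagrangian decompositions *)

Section CocyclePairing.
Variables (K : fieldType) (D : finGroupType) (omega : D -> D -> K).
Hypotheses (omegaP : normalized_2cocycle omega).
Hypothesis (DC : forall x y : D, (x * y = y * x)%g).
Local Notation B := (cocycle_pairing omega).

(** Combine the cocycle identities at (x, y, z), (z, x, y) and (x, z, y), and cancel [omega x y] and
    [omega (x * z) y]. *)
Lemma cocycle_pairingMl x y z : B (x * y)%g z = B x z * B y z.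
Proof.
have [om0 omA _] := omegaP; rewrite /cocycle_pairing mulf_div.
apply/eqP; rewrite eqr_div ?mulf_neq0 //; apply/eqP.
have := omA x z y; rewrite (DC z y).
move: (omA x y z) (omA z x y) (om0 x y) (om0 (x * z)%g y); rewrite (DC z x).
move: (omega _ _) (omega _ _) (omega _ _) (omega _ _) (omega _ _) (omega _ _)
  (omega _ _) (omega _ _) (omega _ _) => a b c d e f g h k E1 E2 a0 f0 E3.
apply: (mulfI (mulf_neq0 a0 f0)).
transitivity ((k * h) * (e * d) * a); first by ring.
rewrite E1 E2; transitivity ((a * f) * g * c * k); first by ring.
by rewrite -E3; ring.
Qed.

Lemma cocycle_pairingV x y : B y x = (B x y)^-1.
Proof. by rewrite /cocycle_pairing invfM invrK mulrC. Qed.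

Lemma cocycle_pairingMr x y z : B x (y * z)%g = B x y * B x z.
Proof. by rewrite !(cocycle_pairingV _ x) cocycle_pairingMl invfM. Qed.

Lemma cocycle_pairing1l x : B 1%g x = 1.
Proof.
rewrite /cocycle_pairing; have [_ _ /(_ x)[-> ->]] := omegaP.
exact: divr1.
Qed.

Lemma cocycle_pairing_invl x y : B x^-1%g y = (B x y)^-1.
Proof.
have Bxy : B x^-1%g y * B x y = 1.
  by rewrite -cocycle_pairingMl mulVg cocycle_pairing1l.
have B0 : B x y != 0.
  by apply: contra_eq_neq Bxy => ->; rewrite mulr0 eq_sym oner_neq0.
by apply: (mulIf B0); rewrite Bxy mulVf.
Qed.

End CocyclePairing.

Section LagrangianDuality.
Variables (K : fieldExtType rat) (A : finGroupType).
Variables (omega : chars K A -> chars K A -> K) (L : {group chars K A}).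
Variable s : chars K [subg L] -> chars K A.
Hypotheses (omegaP : normalized_2cocycle omega).
Hypothesis (decL : lagrangian_decomposition omega s).
Local Notation B := (cocycle_pairing omega).
Local Notation pt := (fun p => lagr_pt s p.1 p.2).

Lemma lagr_section1 : s 1%g = 1%g.
Proof.
have [_ sM _ _] := decL.
by apply: (mulgI (s 1%g)); rewrite -sM !mulg1.
Qed.

Lemma lagr_ptM l l' lam lam' :
  (lagr_pt s l lam * lagr_pt s l' lam')%g = lagr_pt s (l * l')%g (lam * lam')%g.
Proof.
have [_ sM _ _] := decL.
rewrite /lagr_pt sM -!mulgA; congr (_ * _)%g.
by rewrite !mulgA [(s lam * _)%g]char_mulC.
Qed.

Lemma lagr_pt1 : lagr_pt s 1%g 1%g = 1%g.
Proof. by rewrite /lagr_pt lagr_section1 mulg1. Qed.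

Lemma lagr_ptV l lam : (lagr_pt s l lam)^-1%g = lagr_pt s l^-1%g lam^-1%g.
Proof.
by apply: (mulgI (lagr_pt s l lam)); rewrite mulgV lagr_ptM !mulgV lagr_pt1.
Qed.

(** Pairing with the elements of L recovers the second coordinate; the first follows by
    cancellation. *)
Lemma lagr_pt_inj : injective pt.
Proof.
have [_ _ _ Bpt] := decL => -[l lam] [l' lam'] /= eq_pt.
have lamE : lam = lam'.
  apply: char_eqP => k; have := Bpt l' k lam' 1%g.
  by rewrite -eq_pt Bpt !one_charE !invr1 !mulr1.
by move: eq_pt; rewrite /lagr_pt lamE => /mulIg/val_inj->.
Qed.

(** If [lam] is the character of L given by pairing with [phi], then [phi * (s lam)^-1] is
    orthogonal to L, hence in L, as L is its own orthogonal. *)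
Lemma lagr_pt_surj phi : exists p, pt p = phi.
Proof.
have [lagrL _ sB _] := decL; have DC := @char_mulC K A.
have lamP : is_char [ffun l : [subg L] => B phi (sgval l)].
  apply/andP; split.
    by rewrite ffunE cocycle_pairingV cocycle_pairing1l // invr1.
  apply/forallP => a; apply/forallP => b.
  by rewrite !ffunE -cocycle_pairingMr.
pose lam : chars K [subg L] := Chars lamP.
have /lagrL xL : forall l, l \in L -> B (phi * (s lam)^-1)%g l = 1.
  move=> l lL; rewrite cocycle_pairingMl // cocycle_pairing_invl //.
  have -> : B phi l = lam (subg L l) by rewrite ffunE subgK.
  by rewrite -[X in B _ X](subgK _ lL) sB mulfV // char_neq0.
exists (subg L (phi * (s lam)^-1)%g, lam).
by rewrite /lagr_pt /= subgK // mulgKV.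
Qed.

Lemma lagr_pt_bij : bijective pt.
Proof.
have /choice[q qK] := lagr_pt_surj; exists q => // p.
by apply: lagr_pt_inj; rewrite qK.
Qed.

Lemma lagr_dual_ptE lam' l' l lam :
  (lagr_pt s l lam : chars K A) (lagr_dual_pt s lam' l') = lam' l * lam l'.
Proof.
rewrite /lagr_dual_pt; case: pickP => [a|noa].
  by move=> /forallP/(_ l)/forallP/(_ lam)/eqP.
(* The default of [lagr_dual_pt] cannot occur: the prescribed values form a multiplicative function
   on the character group, which [char_bidual] realises as an evaluation. *)
have [q qK Kq] := lagr_pt_bij.
have [||a aP] := @char_bidual K A (fun phi => lam' (q phi).1 * (q phi).2 l').
- by rewrite -lagr_pt1 (qK (1%g, 1%g)) /= Defs.char1 one_charE mulr1.
- move=> phi psi.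
  have -> : q (phi * psi)%g = ((q phi).1 * (q psi).1, (q phi).2 * (q psi).2)%g.
    apply: lagr_pt_inj; rewrite Kq /= -lagr_ptM.
    by rewrite -[phi in LHS]Kq -[psi in LHS]Kq.
  by rewrite Defs.charM mul_charE mulrACA.
case/forallP: (noa a) => k; apply/forallP => mu.
by rewrite aP (qK (k, mu)).
Qed.

End LagrangianDuality.

Lemma sgval_morph (G : finGroupType) (M : {group G}) :
  {morph @sgval G M : a b / (a * b)%g}.
Proof. by []. Qed.

Lemma sum_pair_reindex (K : fieldExtType rat) (A : finGroupType)
    (omega : chars K A -> chars K A -> K) (L : {group chars K A})
    (s : chars K [subg L] -> chars K A) (V : nmodType) (F : chars K A -> V) :
  normalized_2cocycle omega -> lagrangian_decomposition omega s ->
  \sum_phi F phi = \sum_lam \sum_l F (lagr_pt s l lam).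
Proof.
move=> omegaP decL; rewrite exchange_big pair_bigA /=.
by rewrite (reindex _ (onW_bij _ (lagr_pt_bij omegaP decL))).
Qed.

Section LagrangianTwist.
Variables (K : fieldExtType rat) (G : finGroupType) (M : {group G}).
Hypothesis splitM : split_galg K [subg M].
Variable omega : chars K [subg M] -> chars K [subg M] -> K.
Hypothesis omegaP : normalized_2cocycle omega.
Variable L : {group chars K [subg M]}.
Variable s : chars K [subg L] -> chars K [subg M].
Hypothesis decL : lagrangian_decomposition omega s.
Hypothesis omegaE : forall (l l' : [subg L]) (lam lam' : chars K [subg L]),
  omega (lagr_pt s l lam) (lagr_pt s l' lam') = lam l'.

Local Notation eM := (char_idem (@sgval G M)).
Local Notation emb := (fun l : [subg L] => sgval (lagr_emb s l)).
Local Notation eL := (char_idem emb).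
Local Notation tL lam := (sgval (lagr_dual_pt s lam 1%g)).
Implicit Types (lam mu : chars K [subg L]) (l : [subg L]).

Lemma lagr_emb_morph : {morph emb : l k / (l * k)%g}.
Proof.
move=> l k /=; rewrite -(@sgval_morph G M); congr sgval.
apply: (char_separate splitM) => phi.
have [[m mu] <-] := lagr_pt_surj omegaP decL phi.
rewrite Defs.charM /lagr_emb !(lagr_dual_ptE omegaP decL) !one_charE !mul1r.
by rewrite Defs.charM.
Qed.

Lemma lagr_dual_pt1 : tL (1%g : chars K [subg L]) = 1%g.
Proof.
rewrite -[RHS](erefl (sgval (1%g : [subg M]))); congr sgval.
apply: (char_separate splitM) => phi.
have [[m mu] <-] := lagr_pt_surj omegaP decL phi.
by rewrite (lagr_dual_ptE omegaP decL) one_charE !Defs.char1 mulr1.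
Qed.

(** The coefficient of [emb k] at [lagr_pt s l mu] is [mu k], and orthogonality on L keeps only
    [mu = lam]. *)
Lemma lagr_idemE lam : eL lam = \sum_l eM (lagr_pt s l lam).
Proof.
rewrite {1}/char_idem.
under eq_bigr => k _.
  rewrite (gelt_char_idem (@sgval G M) splitM) (sum_pair_reindex _ omegaP decL).
  rewrite scaler_sumr; under eq_bigr => mu _.
    under eq_bigr do rewrite (lagr_dual_ptE omegaP decL) one_charE mul1r.
    rewrite -scaler_sumr scalerA mulrC.
    over.
  over.
rewrite exchange_big /=; under eq_bigr => mu _.
  rewrite -scaler_suml sum_char_mulV.
  over.
rewrite (bigD1 lam) //= [X in _ + X]big1 => [|mu /negbTE->]; last first.
  by rewrite mul0r scale0r.
by rewrite eqxx mul1r addr0 scalerA mulVf ?scale1r // card_neq0.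
Qed.

Lemma gelt_lagr_dual lam :
  gelt K (tL lam) = \sum_mu \sum_l lam l *: eM (lagr_pt s l mu).
Proof.
rewrite (gelt_char_idem (@sgval G M) splitM) (sum_pair_reindex _ omegaP decL).
apply: eq_bigr => mu _; apply: eq_bigr => l _.
by rewrite (lagr_dual_ptE omegaP decL) Defs.char1 mulr1.
Qed.

(** Here [tL lam] is [lam] viewed in M. As [omega] depends only on the dual coordinate of its first
    argument and the L coordinate of its second, the remaining sums assemble into [eL lam] and
    [tL lam]. *)
Lemma twistE : twist omega = \sum_lam tens (eL lam) (gelt K (tL lam)).
Proof.
rewrite /twist (sum_pair_reindex _ omegaP decL); apply: eq_bigr => lam _.
rewrite lagr_idemE tens_suml; apply: eq_bigr => l _.
rewrite (sum_pair_reindex _ omegaP decL) gelt_lagr_dual tens_sumr.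
apply: eq_bigr => mu _; rewrite tens_sumr; apply: eq_bigr => k _.
by rewrite omegaE -tensZr.
Qed.

Lemma lagr_idemM lam mu : eL lam * eL mu = (lam == mu)%:R *: eL lam.
Proof. exact: (char_idemM lagr_emb_morph). Qed.

Lemma sum_lagr_idem : \sum_(lam : chars K [subg L]) eL lam = 1.
Proof.
rewrite -(sum_char_idem (@sgval_morph G M) splitM).
rewrite (sum_pair_reindex _ omegaP decL).
by apply: eq_bigr => lam _; rewrite lagr_idemE.
Qed.

Lemma lagr_idemC lam (m : G) : m \in M -> eL lam * gelt K m = gelt K m * eL lam.
Proof.
move=> mM; rewrite lagr_idemE mulr_suml mulr_sumr; apply: eq_bigr => l _.
rewrite -(subgK _ mM) (char_idem_geltr (@sgval_morph G M)).
by rewrite (char_idem_geltl (@sgval_morph G M)).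
Qed.

Let J' : galg K (G * G)%type :=
  \sum_lam tens (eL lam) (gelt K (tL lam)^-1%g).

Lemma lagr_tens_sumM (f g : chars K [subg L] -> G) :
  (forall lam, (f lam * g lam)%g = 1%g) ->
  (\sum_lam tens (eL lam) (gelt K (f lam))) *
    (\sum_lam tens (eL lam) (gelt K (g lam))) = 1.
Proof.
move=> fg; rewrite mulr_suml -tens11 -[X in tens X _]sum_lagr_idem tens_suml.
apply: eq_bigr => lam _; rewrite mulr_sumr (bigD1 lam) //= [X in _ + X]big1.
  by rewrite tensM geltM fg lagr_idemM eqxx scale1r addr0.
move=> mu; rewrite eq_sym tensM lagr_idemM => /negbTE->.
by rewrite scale0r; apply/ffunP => p; rewrite !ffunE mul0r.
Qed.

Lemma twist_inv :
  (twist omega)^-1 = \sum_lam tens (eL lam) (gelt K (tL lam)^-1%g).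
Proof.
rewrite twistE; set J := \sum_lam _.
have JJ' : J * J' = 1 by apply: lagr_tens_sumM => lam; rewrite mulgV.
have J'J : J' * J = 1 by apply: lagr_tens_sumM => lam; rewrite mulVg.
have JU : J \is a GRing.unit by apply/unitrP; exists J'.
by apply: (mulrI JU); rewrite mulrV.
Qed.

(** The scalar at [lagr_pt s l lam] is [lam l^-1], which is also the value of that character at the
    inverse of [tL lam]. *)
Lemma twist_UE : twist_U omega = \sum_lam eL lam * gelt K (tL lam)^-1%g.
Proof.
rewrite /twist_U (sum_pair_reindex _ omegaP decL); apply: eq_bigr => lam _.
rewrite lagr_idemE mulr_suml; apply: eq_bigr => l _.
have -> : (tL lam)^-1%g = sgval (lagr_dual_pt s lam 1%g)^-1%g by [].
rewrite (char_idem_geltr (@sgval_morph G M)) (lagr_ptV decL) omegaE !charVE.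
by rewrite (lagr_dual_ptE omegaP decL) Defs.char1 mulr1.
Qed.

Lemma lagr_sumM (f g : chars K [subg L] -> G) :
  (forall lam, f lam \in M) ->
  (forall lam, (f lam * g lam)%g = 1%g) ->
  (\sum_lam eL lam * gelt K (f lam)) * (\sum_lam eL lam * gelt K (g lam)) = 1.
Proof.
move=> fM fg; rewrite mulr_suml -sum_lagr_idem.
apply: eq_bigr => lam _; rewrite mulr_sumr (bigD1 lam) //= [X in _ + X]big1.
  rewrite addr0 mulrA -[eL lam * _ * _]mulrA -lagr_idemC ?fM // mulrA.
  by rewrite lagr_idemM eqxx scale1r -mulrA geltM fg mulr1.
move=> mu; rewrite eq_sym mulrA -[eL lam * _ * _]mulrA -lagr_idemC ?fM // mulrA.
by rewrite lagr_idemM => /negbTE->; rewrite scale0r !mul0r.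
Qed.

Lemma twist_U_inv : (twist_U omega)^-1 = \sum_lam eL lam * gelt K (tL lam).
Proof.
rewrite twist_UE; set U := \sum_lam _; set U' := \sum_lam _.
have tLM lam : tL lam \in M by apply: subgP.
have UU' : U * U' = 1.
  by apply: lagr_sumM => lam; rewrite ?groupV ?mulVg.
have U'U : U' * U = 1 by apply: lagr_sumM => lam; rewrite ?mulgV.
have UU : U \is a GRing.unit by apply/unitrP; exists U'.
by apply: (mulrI UU); rewrite mulrV.
Qed.

Variable N : {group G}.
Hypothesis LN : forall l, emb l \in N.
Local Notation eN := (char_idem (@sgval G N)).
Implicit Type al : chars K [subg N].

Fact char_restr_subproof al :
  is_char [ffun l : [subg L] => al (subg N (emb l))].
Proof.
have embM (l k : [subg L]) :
    subg N (emb (l * k)%g) = (subg N (emb l) * subg N (emb k))%g.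
  by apply: val_inj; rewrite /= !subgK ?groupM ?LN // -lagr_emb_morph // LN.
apply/andP; split.
  rewrite ffunE; apply/eqP/(mulfI (char_neq0 al (subg N (emb 1%g)))).
  by rewrite -Defs.charM -embM mulg1 mulr1.
by apply/forallP => a; apply/forallP => b; rewrite !ffunE embM Defs.charM.
Qed.
Definition char_restr al : chars K [subg L] := Chars (char_restr_subproof al).

(** As L lies in N, [emb l] acts on [eN al] by the scalar [al (emb l)]; orthogonality on L does the
    rest. *)
Lemma lagr_idem_mull lam al :
  eL lam * eN al = (lam == char_restr al)%:R *: eN al.
Proof.
rewrite /char_idem -/(eN al) -scalerAl mulr_suml.
under eq_bigr => l _.
  rewrite -scalerAl -(subgK _ (LN l)).
  rewrite (char_idem_geltl (@sgval_morph G N)) scalerA.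
  rewrite mulrC -[al _]/(al (subg N (emb l))).
  have -> : al (subg N (emb l)) = char_restr al l by rewrite ffunE.
  over.
rewrite -scaler_suml sum_char_mulV scalerA mulrCA mulVf ?card_neq0 // mulr1.
by rewrite eq_sym.
Qed.

Lemma lagr_idem_mulr lam al :
  eN al * eL lam = (lam == char_restr al)%:R *: eN al.
Proof.
rewrite -lagr_idem_mull; set e := eN al.
rewrite /char_idem -[LHS]scalerAr -[RHS]scalerAl mulr_sumr mulr_suml.
congr (_ *: _); apply: eq_bigr => l _; rewrite -[LHS]scalerAr -[RHS]scalerAl.
rewrite -(subgK _ (LN l)) (char_idem_geltl (@sgval_morph G N)).
by rewrite (char_idem_geltr (@sgval_morph G N)).
Qed.

Definition twist_elt al : G := tL (char_restr al).

Lemma twist_elt_in al : twist_elt al \in M.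
Proof. exact: subgP. Qed.

Lemma twist_elt1 : twist_elt 1%g = 1%g.
Proof.
rewrite /twist_elt -lagr_dual_pt1; congr (tL _).
by apply: char_eqP => l; rewrite !ffunE.
Qed.

Lemma lagr_sum_tensl (f : chars K [subg L] -> G) al x :
  (\sum_lam tens (eL lam) (gelt K (f lam))) * tens (eN al) x =
  tens (eN al) (gelt K (f (char_restr al)) * x).
Proof.
rewrite mulr_suml (bigD1 (char_restr al)) //= [X in _ + X]big1.
  by rewrite tensM lagr_idem_mull eqxx scale1r addr0.
move=> lam /negbTE lam_al; rewrite tensM lagr_idem_mull lam_al tensZl.
by rewrite scale0r.
Qed.

Lemma lagr_sum_tensr (f : chars K [subg L] -> G) al x :
  tens (eN al) x * (\sum_lam tens (eL lam) (gelt K (f lam))) =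
  tens (eN al) (x * gelt K (f (char_restr al))).
Proof.
rewrite mulr_sumr (bigD1 (char_restr al)) //= [X in _ + X]big1.
  by rewrite tensM lagr_idem_mulr eqxx scale1r addr0.
move=> lam /negbTE lam_al; rewrite tensM lagr_idem_mulr lam_al tensZl.
by rewrite scale0r.
Qed.

Lemma twist_mull al x :
  twist omega * tens (eN al) x = tens (eN al) (gelt K (twist_elt al) * x).
Proof. by rewrite twistE lagr_sum_tensl. Qed.

Lemma twist_mulr al x :
  tens (eN al) x * twist omega = tens (eN al) (x * gelt K (twist_elt al)).
Proof. by rewrite twistE lagr_sum_tensr. Qed.

Lemma twist_inv_mull al x :
  (twist omega)^-1 * tens (eN al) x =
  tens (eN al) (gelt K (twist_elt al)^-1%g * x).
Proof.
by rewrite twist_inv (lagr_sum_tensl (fun lam => (tL lam)^-1%g)).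
Qed.

Lemma twist_inv_mulr al x :
  tens (eN al) x * (twist omega)^-1 =
  tens (eN al) (x * gelt K (twist_elt al)^-1%g).
Proof.
by rewrite twist_inv (lagr_sum_tensr (fun lam => (tL lam)^-1%g)).
Qed.

Lemma twist_U_mull al :
  twist_U omega * eN al = gelt K (twist_elt al)^-1%g * eN al.
Proof.
rewrite twist_UE mulr_suml (bigD1 (char_restr al)) //= [X in _ + X]big1.
  rewrite addr0 lagr_idemC ?groupV ?subgP // -mulrA lagr_idem_mull eqxx.
  by rewrite scale1r.
move=> lam /negbTE lam_al; rewrite lagr_idemC ?groupV ?subgP // -mulrA.
by rewrite lagr_idem_mull lam_al scale0r mulr0.
Qed.

Lemma twist_U_inv_mulr al :
  eN al * (twist_U omega)^-1 = eN al * gelt K (twist_elt al).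
Proof.
rewrite twist_U_inv mulr_sumr (bigD1 (char_restr al)) //= [X in _ + X]big1.
  by rewrite addr0 mulrA lagr_idem_mulr eqxx scale1r.
move=> lam /negbTE lam_al.
by rewrite mulrA lagr_idem_mulr lam_al scale0r mul0r.
Qed.

End LagrangianTwist.

(** * Cosets of N and the conjugation action on its characters *)

Section ConjugationOnCharacters.
Variables (K : fieldExtType rat) (G : finGroupType) (N : {group G}).
Hypothesis nN : (N <| [set: G])%g.
Local Notation eN := (char_idem (@sgval G N)).
Implicit Types (al be : chars K [subg N]) (g h : G) (n : [subg N]).

Lemma conj_in_normal x g : x \in N -> (x ^ g)%g \in N.
Proof.
move=> xN; rewrite memJ_norm //.
by apply: (subsetP (normal_norm nN)); rewrite inE.
Qed.

Fact conj_char_subproof g al :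
  is_char [ffun n : [subg N] => al (subg N (sgval n ^ g)%g)].
Proof.
apply/andP; split.
  rewrite ffunE (_ : subg N _ = 1%g) ?Defs.char1 //.
  by apply: val_inj; rewrite /= conj1g subgK.
apply/forallP => a; apply/forallP => b; rewrite !ffunE -Defs.charM.
apply/eqP; congr (al _); apply: val_inj.
by rewrite [RHS](@sgval_morph G N) !subgK ?conj_in_normal ?subgP // conjMg.
Qed.
(** As [n ^ g] is [g^-1 n g], this is a left action of G, normalised so that [gelt g * eN al = eN
    (conj_char g al) * gelt g]. *)
Definition conj_char g al : chars K [subg N] := Chars (conj_char_subproof g al).

Lemma conj_charE g al n : conj_char g al n = al (subg N (sgval n ^ g)%g).
Proof. by rewrite ffunE. Qed.

Lemma conj_char_comp g h al :
  conj_char (g * h)%g al = conj_char g (conj_char h al).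
Proof.
apply: char_eqP => n; rewrite !conj_charE; congr (al _); apply: val_inj.
by rewrite /= !subgK ?conj_in_normal ?subgP // conjgM.
Qed.

Lemma conj_char1 al : conj_char 1%g al = al.
Proof. by apply: char_eqP => n; rewrite conj_charE conjg1 sgvalK. Qed.

Lemma conj_charK g : cancel (conj_char g) (conj_char g^-1%g).
Proof. by move=> al; rewrite -conj_char_comp mulVg conj_char1. Qed.

Lemma conj_charVK g : cancel (conj_char g^-1%g) (conj_char g).
Proof. by move=> al; rewrite -conj_char_comp mulgV conj_char1. Qed.

Lemma conj_charV g al : conj_char g al^-1%g = (conj_char g al)^-1%g.
Proof. by apply: char_eqP => n; rewrite inv_charE !conj_charE inv_charE. Qed.

Lemma conj_char_one g : conj_char g 1%g = 1%g.
Proof. by apply: char_eqP => n; rewrite conj_charE !one_charE. Qed.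

Lemma gelt_char_idemJ g al : gelt K g * eN al = eN (conj_char g al) * gelt K g.
Proof.
rewrite /char_idem -[LHS]scalerAr -[RHS]scalerAl; congr (_ *: _).
rewrite mulr_sumr mulr_suml.
have conj_inj : injective (fun n : [subg N] => subg N (sgval n ^ g)%g).
  move=> a b /(congr1 sgval); rewrite !subgK ?conj_in_normal ?subgP //.
  by move/conjg_inj/val_inj.
rewrite [LHS](reindex_inj conj_inj); apply: eq_bigr => n _.
rewrite -[LHS]scalerAr -[RHS]scalerAl !geltM; congr (_ *: gelt K _).
  rewrite conj_charE; congr (al _); apply: val_inj.
  by rewrite /= !subgK ?groupV ?conj_in_normal ?groupV ?subgP // conjVg.
by rewrite subgK ?conj_in_normal ?subgP // -conjgC.
Qed.

Lemma conj_char_abelian h al : abelian N -> h \in N -> conj_char h al = al.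
Proof.
move=> abN hN; apply: char_eqP => n; rewrite conj_charE conjgE.
by rewrite (centsP abN _ (subgP n) h hN) mulKg sgvalK.
Qed.

(** Characters separate the points of N, so an [h] fixing all of them centralises N. *)
Lemma conj_char_faithful h : split_galg K [subg N] -> abelian N ->
    [faithful ([set: G] / N)%g, on N | ('J %% N)%act] ->
  (forall al, conj_char h al = al) -> h \in N.
Proof.
move=> splitN abN faithN fix_h.
have hNN : h \in 'N(N)%g by apply: (subsetP (normal_norm nN)); rewrite inE.
have Nh : coset N h \in ([set: G] / N)%g by rewrite mem_quotient ?inE.
apply: coset_idr => //; apply/set1P; apply: (subsetP faithN).
rewrite inE Nh !inE Nh /=.
apply/subsetP => x xN; rewrite inE; apply/eqP.
(* The quotient action is computed by [modactE] once N is known to fix [x], which holds as N is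
   abelian. *)
rewrite modactE ?in_setT //; last first.
  apply/afixP => a; rewrite inE => /andP[_ aN].
  by rewrite /= conjgE (centsP abN x xN a aN) mulKg.
rewrite /= -[x in LHS](subgK _ xN) -[RHS](subgK _ xN).
rewrite -[LHS](subgK _ (conj_in_normal h (subgP (subg N x)))); congr sgval.
by apply: (char_separate splitN) => al; rewrite -conj_charE fix_h.
Qed.

Lemma char_idem_val al n : eN al (sgval n) = #|[subg N]|%:R^-1 * al n^-1%g.
Proof.
rewrite galgZE sum_ffunE (bigD1 n) //= big1 => [|a /negbTE an].
  by rewrite galgZE ffunE eqxx mulr1 addr0.
by rewrite galgZE ffunE (inj_eq val_inj) eq_sym an mulr0.
Qed.

(** The coordinate of [eN al * y] along [eN al * gelt k], as [idem_coset_part] shows. *)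
Definition coset_coef al k (y : galg K G) : K :=
  \sum_(n : [subg N]) al n * y (sgval n * k)%g.

Definition coset_part k (y : galg K G) : galg K G :=
  galg_restr (fun g => (g * k^-1)%g \in N) y.

Lemma coset_coefZ al k a y : coset_coef al k (a *: y) = a * coset_coef al k y.
Proof.
rewrite mulr_sumr; apply: eq_bigr => n _.
by rewrite galgZE mulrCA.
Qed.

Lemma coset_coefP al k a x y :
  coset_coef al k (a *: x + y) = a * coset_coef al k x + coset_coef al k y.
Proof.
rewrite mulr_sumr -big_split /=.
by apply: eq_bigr => n _; rewrite !ffunE mulrDr mulrCA.
Qed.

(** Coproducts, antipodes and sums of coefficients all have the shape [\sum_g x g *: W g]; for this
    [x] the support is the coset N k. *)
Lemma char_idem_gelt_sum (V : lmodType K) al k (W : G -> V) :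
  \sum_g (eN al * gelt K k) g *: W g =
  #|[subg N]|%:R^-1 *: \sum_(n : [subg N]) al n^-1%g *: W (sgval n * k)%g.
Proof.
rewrite (bigID (fun g => (g * k^-1)%g \in N)) /= [X in _ + X]big1 => [|g gN].
  rewrite addr0 scaler_sumr (reindex_onto (fun n : [subg N] => (sgval n * k)%g)
    (fun g => subg N (g * k^-1)%g)) /= => [|g gN]; last first.
    by rewrite subgK // mulgKV.
  apply: eq_big => [n|n _]; first by rewrite mulgK subgP sgvalK eqxx.
  by rewrite mul_geltE mulgK char_idem_val scalerA.
rewrite mul_geltE galgZE sum_ffunE big1 ?mulr0 ?scale0r // => n _.
rewrite galgZE ffunE; case: eqP => [gn|]; last by rewrite mulr0.
by case/negP: gN; rewrite gn subgP.
Qed.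

Lemma coset_coef_idem al k : coset_coef al k (eN al * gelt K k) = 1.
Proof.
rewrite /coset_coef.
under eq_bigr => n _.
  rewrite mul_geltE mulgK char_idem_val mulrCA charVE mulfV ?char_neq0 // mulr1.
  over.
by rewrite sumr_const -[RHS](mulVf (card_neq0 K [subg N])) mulr_natr.
Qed.

Lemma idem_coset_part al k y :
  eN al * coset_part k y = coset_coef al k y *: (eN al * gelt K k).
Proof.
rewrite /coset_part galg_restrE mulr_sumr scaler_suml.
have subgKk g : (g * k^-1)%g \in N -> (sgval (subg N (g * k^-1)) * k)%g = g.
  by move=> gN; rewrite subgK // mulgKV.
rewrite (reindex_onto (fun n : [subg N] => (sgval n * k)%g)
  (fun g => subg N (g * k^-1)%g)) //=.
apply: eq_big => [n|n _]; first by rewrite mulgK subgP sgvalK eqxx.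
rewrite -scalerAr -geltM mulrA (char_idem_geltr (@sgval_morph G N)) -scalerAl.
by rewrite scalerA mulrC.
Qed.

Lemma coset_partK y : y = \sum_(k | repr (N :* k)%g == k) coset_part k y.
Proof.
rewrite {1}(galgE y) (partition_big (fun g => repr (N :* g)%g)
  (fun k => repr (N :* k)%g == k)) => [|g _] /=; last first.
  by rewrite rcoset_repr.
apply: eq_bigr => k /eqP kE; rewrite /coset_part galg_restrE.
apply: eq_bigl => g.
rewrite -mem_rcoset; apply/eqP/idP => [<-|gk].
  by rewrite rcoset_repr rcoset_refl.
by rewrite -(rcoset_eqP gk) in kE *.
Qed.

End ConjugationOnCharacters.

(** * Hopf orders of the twisted group algebra *)

Section TwistedOrders.
Variables (K : fieldExtType rat) (G : finGroupType) (N : {group G}).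
Hypotheses (nN : (N <| [set: G])%g) (abN : abelian N).
Hypothesis splitN : split_galg K [subg N].
Hypothesis faithN : [faithful ([set: G] / N)%g, on N | ('J %% N)%act].
Local Notation R := (@ring_of_integers K).
Local Notation KG := (galg K G).
Local Notation hatN := (chars K [subg N]).
Local Notation eN := (char_idem (@sgval G N)).
Local Notation cj := (conj_char nN).
Implicit Types (al be ga : hatN) (g h k : G) (x y : KG).

(** The twist is abstracted to its action on the idempotents of N. In the application [tau] has
    values in M, which is abelian and contains L, whence [tau_conj]. *)
Variables (J : galg K (G * G)%type) (U : KG) (tau : hatN -> G).
Hypothesis J_mull : forall al x,
  J * tens (eN al) x = tens (eN al) (gelt K (tau al) * x).
Hypothesis J_mulr : forall al x,
  tens (eN al) x * J = tens (eN al) (x * gelt K (tau al)).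
Hypothesis JV_mull : forall al x,
  J^-1 * tens (eN al) x = tens (eN al) (gelt K (tau al)^-1%g * x).
Hypothesis JV_mulr : forall al x,
  tens (eN al) x * J^-1 = tens (eN al) (x * gelt K (tau al)^-1%g).
Hypothesis U_mull : forall al, U * eN al = gelt K (tau al)^-1%g * eN al.
Hypothesis UV_mulr : forall al, eN al * U^-1 = eN al * gelt K (tau al).
Hypothesis tau1 : tau 1%g = 1%g.
Hypothesis tauV : forall al, tau al^-1%g = (tau al)^-1%g.
Hypothesis tau_conj : forall al be, tau (cj (tau al) be) = tau be.

Let H : hopf_ops K G :=
  HopfOps (fun x => J * comul (group_hopf K G) x * J^-1)
          (counit (group_hopf K G))
          (fun x => U * antipode (group_hopf K G) x * U^-1).

(* The coproduct of e_de g is the sum of the e_al g (x) e_ga (tri al g) over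
   the pairs with circ al ga = de.  The law circ makes hatN a group, with
   inverse hinv, whose group algebra is dual to (KN)_J. *)
Definition circ al ga : hatN := (al * cj (tau al)^-1%g ga)%g.
Definition hinv al : hatN := cj (tau al) al^-1%g.
Definition tri al g : G := (tau al * g * (tau (cj g^-1%g al))^-1)%g.

Lemma circ_inj al : injective (circ al).
Proof. by move=> be ga /mulgI/(can_inj (conj_charK nN _)). Qed.

Lemma circ_hinv al : circ al (hinv al) = 1%g.
Proof. by rewrite /circ /hinv conj_charK mulgV. Qed.

Lemma hinv_inj : injective hinv.
Proof.
move=> al be eq_hinv.
(* By [tau_conj] and [tauV], [tau (hinv al)] is the inverse of [tau al]. *)
have eq_tau : tau al = tau be.
  by apply: invg_inj; rewrite -!tauV -(tau_conj al) -[RHS](tau_conj be)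
    -/(hinv _) eq_hinv.
move: eq_hinv; rewrite /hinv eq_tau.
by move/(can_inj (conj_charK nN _))/invg_inj.
Qed.

(** The right side depends on [g] only through [tri al g], so the last factor of [tri al g] can be
    recovered from it; this makes [tri al] injective. *)
Lemma tau_triV al g :
  tau (cj g^-1%g al) = tau (cj (tri al g)^-1%g (cj (tau al) al)).
Proof.
rewrite -[in RHS]conj_char_comp /tri !invMg invgK -!mulgA mulVg mulg1.
by rewrite conj_char_comp tau_conj.
Qed.

Lemma tri_inj al : injective (tri al).
Proof.
move=> g h eq_tri; have := eq_tri; rewrite {1 2}/tri.
have -> : tau (cj g^-1%g al) = tau (cj h^-1%g al).
  by rewrite tau_triV eq_tri -tau_triV.
by move/mulIg/mulgI.
Qed.

Lemma antipode_mul x y :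
  antipode (group_hopf K G) (x * y) =
  antipode (group_hopf K G) y * antipode (group_hopf K G) x.
Proof.
have antiE z : antipode (group_hopf K G) z = [ffun g => z g^-1%g].
  rewrite [RHS]galgE (reindex_inj invg_inj) /=; apply: eq_bigr => g _.
  by rewrite ffunE invgK.
rewrite !antiE; apply/ffunP => g; rewrite !ffunE.
rewrite [RHS](reindex_inj (mulgI g)) /=.
by apply: eq_bigr => h _; rewrite !ffunE mulrC !invMg !invgK mulKg.
Qed.

Lemma antipode_gelt g : antipode (group_hopf K G) (gelt K g) = gelt K g^-1%g.
Proof.
rewrite /= (bigD1 g) //= [X in _ + X]big1 => [|h /negbTE hg].
  by rewrite ffunE eqxx scale1r addr0.
by rewrite ffunE hg scale0r.
Qed.

Lemma antipode_is_linear : linear (antipode (group_hopf K G)).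
Proof.
move=> a x y; rewrite /= scaler_sumr -big_split /=; apply: eq_bigr => g _.
by rewrite scalerA -scalerDl; congr (_ *: _); rewrite !ffunE.
Qed.

Lemma antipode_char_idem al : antipode (group_hopf K G) (eN al) = eN al^-1%g.
Proof.
rewrite [LHS]/= -[eN al]mulr1 -gelt1 char_idem_gelt_sum; congr (_ *: _).
rewrite (reindex_inj invg_inj) /=; apply: eq_bigr => n _.
by rewrite invgK inv_charE charVE invrK mulg1 invgK.
Qed.

Lemma antipodeE x :
  antipode H x = U * antipode (group_hopf K G) x * U^-1.
Proof. by []. Qed.

Lemma comulE x : comul H x = J * comul (group_hopf K G) x * J^-1.
Proof. by []. Qed.

(** Hence [eN al * gelt g] times this antipode is [eN al]: the antipode axiom localised at a single
    tensor of the coproduct. *)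
Lemma antipode_hinv al g :
  antipode H (eN (hinv al) * gelt K (tri al g)) = gelt K g^-1%g * eN al.
Proof.
rewrite antipodeE antipode_mul antipode_gelt antipode_char_idem /hinv.
rewrite -conj_charV invgK.
rewrite /tri; set be := cj g^-1%g al; set t := tau al; set t' := tau be.
rewrite !invMg invgK -!geltM -!mulrA (mulrA U).
have -> : gelt K t^-1%g * (eN (cj t al) * U^-1) = eN al.
  rewrite UV_mulr tau_conj -/t -gelt_char_idemJ mulrA geltM mulVg.
  by rewrite gelt1 mul1r.
have Ube : U * (gelt K t' * eN be) = eN be.
  rewrite gelt_char_idemJ mulrA U_mull tau_conj -/t' -mulrA -gelt_char_idemJ.
  by rewrite mulrA geltM mulVg gelt1 mul1r.
by rewrite gelt_char_idemJ -/be -mulrA (mulrA (gelt K t')) mulrA Ube.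
Qed.

(** On this corner the twist acts through [tau al] and [tau be], and [eN al * gelt g * eN be]
    vanishes unless [g] carries [be] to [al]. *)
Lemma comul_corner al be y :
  tens (eN al) 1 * comul H y * tens (eN be) 1 =
  \sum_(g | cj g be == al) y g *:
    tens (eN al * gelt K g) (gelt K (tau al * g * (tau be)^-1)%g).
Proof.
rewrite comulE !mulrA J_mulr mul1r -!mulrA JV_mull mulr1.
rewrite mulr_suml mulr_sumr [RHS]big_mkcond /=; apply: eq_bigr => g _.
rewrite -scalerAl -scalerAr !tensM !geltM !mulgA gelt_char_idemJ mulrA.
rewrite char_idemM //.
rewrite eq_sym; case: eqP => _; first by rewrite scale1r.
rewrite scale0r mul0r; apply/ffunP => p.
by rewrite galgZE !ffunE mul0r mulr0.
Qed.

(** * Integrality in an order and its decomposition along the cosets of N *)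

Variable Y : set KG.
Hypothesis orderY : hopf_order R H Y.

Let Ysub : is_submodule R Y. Proof. by case: orderY => -[]. Qed.
Let YZ r x : R r -> Y x -> Y (r *: x). Proof. by case: Ysub => _ _; apply. Qed.
Let Y1 : Y 1. Proof. by case: orderY => _ []. Qed.
Let YM x y : Y x -> Y y -> Y (x * y).
Proof. by case: orderY => _ [_ YM _ _ _]; apply: YM. Qed.
Let YS x : Y x -> Y (antipode H x).
Proof. by case: orderY => _ [_ _ _ _]; apply. Qed.
Let Yint (f : {linear KG -> K^o}) d :=
  @order_integral K G Y Ysub (let: conj (And3 _ p _) _ := orderY in p)
    (let: conj (And3 _ _ b) _ := orderY in b) f d.
Let Ydual := @dual_basis K G Y Ysub (let: conj (And3 _ p _) _ := orderY in p)
    (let: conj (And3 _ _ b) _ := orderY in b).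

(** Multiplication by [u] scales by [d] the nonzero functional reading the coefficient of
    [eN al * y] at the identity, so [order_integral] applies. *)
Lemma char_idem_eigen_integral al u d : Y u -> eN al * u = d *: eN al -> R d.
Proof.
move=> Yu eu.
have f_lin : linear (fun y : KG => (eN al * y) 1%g : K^o).
  by move=> a x y; rewrite mulrDr -scalerAr !ffunE.
pose f : {linear KG -> K^o} := HB.pack (fun y : KG => (eN al * y) 1%g : K^o)
  (GRing.isLinear.Build _ _ _ _ _ f_lin).
apply: (@Yint f) => [|y Yy].
  exists 1 => /=; rewrite mulr1 -[1%g]/(sgval (1%g : [subg N])) char_idem_val.
  by rewrite invg1 Defs.char1 mulr1 invr_neq0 // card_neq0.
by exists (u * y); [exact: YM | rewrite /= mulrA eu -scalerAl galgZE].
Qed.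

Lemma char_idem_coef_integral al c : Y (c *: eN al) -> R c.
Proof.
move=> Yce; apply: (char_idem_eigen_integral (al := al) Yce).
by rewrite -scalerAr (char_idem_id (@sgval_morph G N)).
Qed.

Lemma group_comul_char_idem :
  comul (group_hopf K G) (eN 1%g) = \sum_al tens (eN al) (eN al^-1%g).
Proof.
rewrite [LHS]/= -[eN 1%g]mulr1 -gelt1 char_idem_gelt_sum.
transitivity (#|[subg N]|%:R^-1 *: \sum_(n : [subg N]) \sum_(al : hatN)
   al n *: tens (eN al) (gelt K (sgval n))).
  congr (_ *: _); apply: eq_bigr => n _.
  rewrite one_charE scale1r mulg1 {1}(gelt_char_idem _ splitN) tens_suml.
  by apply: eq_bigr => al _; rewrite tensZl.
rewrite exchange_big scaler_sumr; apply: eq_bigr => al _.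
rewrite [eN al^-1%g]/char_idem tensZr tens_sumr; congr (_ *: _).
apply: eq_bigr => n _; rewrite -tensZr inv_charE charVE invrK.
by rewrite tensZr.
Qed.

(** Conjugation by [tau al] turns the [al^-1] of the untwisted coproduct into [hinv al]. *)
Lemma comul_char_idem : comul H (eN 1%g) = \sum_al tens (eN al) (eN (hinv al)).
Proof.
rewrite comulE group_comul_char_idem.
rewrite mulr_sumr mulr_suml; apply: eq_bigr => al _.
rewrite J_mull JV_mulr; congr tens.
by rewrite gelt_char_idemJ -mulrA geltV mulr1.
Qed.

(* Applying the coordinate u j to one factor of the coproduct of e_1 gives
   \sum_be u j (e_be) e_(hinv be) \in Y, so u j (e_al) is an eigenvalue of an
   element of Y. *)
Lemma char_idem_in_order : Y (eN 1%g) -> forall al, Y (eN al).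
Proof.
move=> Ye al; have [n [u [p [Yp Ru pE]]]] := Ydual.
rewrite (pE (eN al)); apply: (submodule_sum Ysub) => j _; apply: YZ => //.
have [||f fE] := @tens_lift K G KG (fun x y => u j x *: y).
- by move=> y a v w; rewrite linearP scalerDl scalerA.
- by move=> x a v w; rewrite scalerDr !scalerA mulrC.
pose v := \sum_be u j (eN be) *: eN (hinv be).
have Yv : Y v.
  have [m [x [y [Yx Yy xyE]]]] : tens_square Y (comul H (eN 1%g)).
    by case: orderY => _ [_ _ YDelta _ _]; apply: YDelta.
  have -> : v = f (comul H (eN 1%g)).
    by rewrite comul_char_idem linear_sum; apply: eq_bigr => be _; rewrite fE.
  rewrite xyE linear_sum; apply: (submodule_sum Ysub) => i _.
  by rewrite fE; apply: YZ => //; apply: Ru.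
apply: (char_idem_eigen_integral (al := hinv al) Yv).
rewrite mulr_sumr (bigD1 al) //= [X in _ + X]big1 => [|be be_al].
  by rewrite -scalerAr (char_idem_id (@sgval_morph G N)) addr0.
rewrite -scalerAr (char_idemM (@sgval_morph G N)) (inj_eq hinv_inj) eq_sym.
by rewrite (negbTE be_al) scale0r scaler0.
Qed.

Hypothesis Ye : forall al, Y (eN al).

(** As the idempotents lie in Y, a corner of the coproduct stays in the image of Y (x) Y, where [B]
    can be evaluated termwise. *)
Lemma corner_lift (V : lmodType K) (B : KG -> KG -> V) al be y :
    (forall y, linear (B^~ y)) -> (forall x, linear (B x)) -> Y y ->
  exists n (x z : 'I_n -> KG),
    [/\ forall j, Y (x j), forall j, Y (z j)
      & \sum_(g | cj g be == al) y g *: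
          B (eN al * gelt K g) (gelt K (tau al * g * (tau be)^-1)%g)
        = \sum_j B (x j) (z j)].
Proof.
move=> Bl Br Yy; have [f fE] := tens_lift Bl Br.
have [n [x [z [Yx Yz xzE]]]] : tens_square Y (comul H y).
  by case: orderY => _ [_ _ YDelta _ _]; apply: YDelta.
exists n, (fun j => eN al * x j * eN be), z; split=> // [j|].
  by apply: YM => //; apply: YM.
transitivity (f (tens (eN al) 1 * comul H y * tens (eN be) 1)).
  rewrite comul_corner linear_sum; apply: eq_bigr => g _.
  by rewrite linearZ fE.
rewrite xzE mulr_sumr mulr_suml linear_sum; apply: eq_bigr => j _.
by rewrite !tensM mul1r mulr1 fE.
Qed.

(* These are the matrix coefficients of the permutation representation of G on
   hatN.  Convolving them with the coproduct cuts elements of Y down to cosets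
   of N, because the representation is faithful on G / N. *)
Lemma perm_coef_integral al be y :
  Y y -> R (\sum_(g | cj g be == al) y g).
Proof.
move=> Yy.
have [] := @corner_lift _
  (fun x z => x * antipode H (eN (hinv al) * z)) al be y.
- by move=> z a v w; rewrite mulrDl scalerAl.
- move=> x a v w; rewrite mulrDr -scalerAr !antipodeE antipode_is_linear.
  by rewrite mulrDr !mulrDl mulrDr -!scalerAr -!scalerAl -scalerAr.
- by [].
move=> n [x [z [Yx Yz E]]]; apply: (@char_idem_coef_integral al).
(* By [antipode_hinv], each tensor of the corner is sent to [eN al]. *)
have -> : (\sum_(g | cj g be == al) y g) *: eN al =
    \sum_j x j * antipode H (eN (hinv al) * z j).
  rewrite -E scaler_suml; apply: eq_bigr => g /eqP gbe; congr (_ *: _).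
  rewrite -gbe; set be' := cj g be.
  rewrite (_ : be = cj g^-1%g be'); last by rewrite conj_charK.
  rewrite -/(tri be' g) antipode_hinv mulrA -(mulrA (eN _)) geltV mulr1.
  by rewrite (char_idem_id (@sgval_morph G N)).
apply: (submodule_sum Ysub) => j _; apply: YM => //; apply: YS.
exact: YM.
Qed.

Lemma sum_coset_restr (W : G -> bool) al k c :
  \sum_(g | W g) (c *: (eN al * gelt K k)) g =
  c * (#|[subg N]|%:R^-1 * \sum_(n | W (sgval n * k)%g) al n^-1%g).
Proof.
rewrite big_mkcond [in RHS]big_mkcond /=.
transitivity (c * \sum_g (eN al * gelt K k) g *: ((W g)%:R : K^o)).
  rewrite mulr_sumr; apply: eq_bigr => g _; rewrite galgZE.
  by case: (W g); rewrite /GRing.scale /= ?mulr1 ?mulr0.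
rewrite char_idem_gelt_sum; congr (_ * (_ * _)); apply: eq_bigr => n _.
by case: (W _); rewrite /GRing.scale /= ?mulr1 ?mulr0.
Qed.

Lemma conj_char_coset n k be : cj (sgval (n : [subg N]) * k)%g be = cj k be.
Proof. by rewrite conj_char_comp conj_char_abelian ?subgP. Qed.

(** The corner at the trivial characters consists of the tensors of [eN 1 * gelt g] and [gelt g].
    The functional [t], integral on Y, is 1 or 0 on the first factor according to the condition on
    [g], which is constant on cosets of N. *)
Lemma perm_part_in_order al be y :
  Y y -> Y (galg_restr (fun g => cj g be == al) y).
Proof.
move=> Yy.
pose t x : K := \sum_(g | cj g be == al) x g.
have t_lin x z a : t (a *: x + z) = a * t x + t z.
  rewrite /t mulr_sumr -big_split /=; apply: eq_bigr => g _.
  by rewrite !ffunE.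
have [] := @corner_lift _ (fun x z => t x *: z) 1%g 1%g y.
- by move=> z a v w; rewrite t_lin scalerDl scalerA.
- by move=> x a v w; rewrite scalerDr !scalerA mulrC.
- by [].
move=> n [x [z [Yx Yz E]]].
suff -> : galg_restr (fun g => cj g be == al) y = \sum_j t (x j) *: z j.
  apply: (submodule_sum Ysub) => j _; apply: YZ => //.
  exact: perm_coef_integral.
rewrite -E galg_restrE big_mkcond [RHS]big_mkcond /=; apply: eq_bigr => g _.
rewrite conj_char_one eqxx tau1 invg1 mul1g mulg1 /t.
rewrite -[eN 1%g * _]scale1r sum_coset_restr mul1r.
under eq_bigl do rewrite conj_char_coset.
case: eqP => _; last by rewrite big_pred0_eq mulr0 scale0r scaler0.
under eq_bigr do rewrite one_charE.
by rewrite sumr_const mulVf ?scale1r // card_neq0.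
Qed.

(** Imposing [cj g be = cj k be] for every [be] in turn cuts the support down to N k, by
    faithfulness. *)
Lemma coset_part_in_order k y : Y y -> Y (coset_part N k y).
Proof.
move=> Yy.
have Yrestr (s : seq hatN) :
    Y (galg_restr (fun g => all (fun be => cj g be == cj k be) s) y).
  elim: s => [|be s IHs] /=.
    by rewrite (_ : galg_restr _ y = y) //; apply/ffunP => g; rewrite ffunE.
  rewrite (_ : galg_restr _ y = galg_restr (fun g => cj g be == cj k be)
    (galg_restr (fun g => all (fun be => cj g be == cj k be) s) y)).
    exact: perm_part_in_order.
  by apply/ffunP => g; rewrite !ffunE; case: (cj g be == _).
rewrite (_ : coset_part N k y = galg_restr
  (fun g => all (fun be => cj g be == cj k be) (enum {: hatN})) y) //.
apply/ffunP => g; rewrite !ffunE; congr (if _ then _ else _).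
apply/idP/allP => [gk be _|fix_gk].
  by rewrite -[g](mulgKV k) conj_char_comp conj_char_abelian.
apply: (conj_char_faithful splitN abN faithN) => al.
rewrite conj_char_comp.
have /eqP -> : cj g (cj k^-1%g al) == cj k (cj k^-1%g al).
  by apply: fix_gk; rewrite mem_enum.
by rewrite conj_charVK.
Qed.

(** * The coefficient modules I(nu, g) of an order *)

Definition coset_ideal al g : set K := fun c => Y (c *: (eN al * gelt K g)).

Lemma coset_ideal_coef al g y : Y y -> coset_ideal al g (coset_coef al g y).
Proof.
move=> Yy; rewrite /coset_ideal -idem_coset_part.
by apply: YM => //; apply: coset_part_in_order.
Qed.

(** Applying [u j] to the first factor of the corner multiplies the coefficient of [y] at [g] by
    [u j (eN 1 * gelt g)] and preserves Y; so this coordinate is an eigenvalue, hence integral. *)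
Lemma trivial_char_idem_mul_in_order g : Y (eN 1%g * gelt K g).
Proof.
have [n [u [p [Yp Ru pE]]]] := Ydual.
rewrite (pE (_ * _)); apply: (submodule_sum Ysub) => j _; apply: YZ => //.
have f_lin : linear (fun y : KG => y g : K^o).
  by move=> a x y; rewrite !ffunE.
pose f : {linear KG -> K^o} := HB.pack (fun y : KG => y g : K^o)
  (GRing.isLinear.Build _ _ _ _ _ f_lin).
apply: (@Yint f) => [|y Yy].
  by exists (gelt K g); rewrite /= ffunE eqxx oner_eq0.
have [] := @corner_lift _ (fun x z => u j x *: z) 1%g 1%g y.
- by move=> z a v w; rewrite linearP scalerDl scalerA.
- by move=> x a v w; rewrite scalerDr !scalerA mulrC.
- by [].
move=> m [x [z [Yx Yz E]]].
exists (\sum_j0 u j (x j0) *: z j0).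
  by apply: (submodule_sum Ysub) => i _; apply: YZ => //; apply: Ru.
rewrite -E /= sum_ffunE big_mkcond (bigD1 g) //= [X in _ + X]big1 => [|h hg].
  rewrite conj_char_one eqxx tau1 invg1 mul1g mulg1 addr0 !galgZE ffunE eqxx.
  by rewrite mulr1 mulrC.
rewrite conj_char_one eqxx tau1 invg1 mul1g mulg1 !galgZE ffunE eq_sym.
by rewrite (negbTE hg) !mulr0.
Qed.

(** Apply the two coordinate functionals to the factors of the coproduct: the explicit formula gives
    [c], a presentation in Y (x) Y gives the sum of products. *)
Lemma coset_ideal_circ al ga g c : coset_ideal (circ al ga) g c ->
  exists n (a b : 'I_n -> K), [/\ forall j, coset_ideal al g (a j),
    forall j, coset_ideal ga (tri al g) (b j) & c = \sum_j a j * b j].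
Proof.
rewrite /coset_ideal; set y := c *: _ => Yc; set be := cj g^-1%g al.
have [] := @corner_lift K^o
  (fun x z => coset_coef al g x * coset_coef ga (tri al g) z) al be y.
- by move=> z a v w; rewrite coset_coefP mulrDl -mulrA.
- by move=> x a v w; rewrite coset_coefP mulrDr mulrCA.
- by [].
move=> n [x [z [Yx Yz E]]].
exists n, (fun j => coset_coef al g (x j)),
  (fun j => coset_coef ga (tri al g) (z j)).
split=> [j|j|]; [exact: coset_ideal_coef..|].
rewrite -E {E x z Yx Yz}.
pose W h : K^o := if cj h be == al then
  coset_coef al g (eN al * gelt K h) *
  coset_coef ga (tri al g) (gelt K (tau al * h * (tau be)^-1)%g) else 0.
transitivity (c * \sum_h (eN (circ al ga) * gelt K g) h *: W h); last first.
  rewrite mulr_sumr [RHS]big_mkcond /=; apply: eq_bigr => h _.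
  rewrite galgZE /W; case: ifP => _; last by rewrite scaler0 mulr0.
  exact: mulrA.
rewrite char_idem_gelt_sum -[LHS]mulr1; congr (_ * _).
(* The first factor gives [al n'], the second [ga] at the conjugate of [n'] by the inverse of
   [tau al]. The product cancels the coefficient of the idempotent. *)
have WE n' : W (sgval n' * g)%g = circ al ga n'.
  rewrite /W conj_char_coset conj_charVK eqxx -geltM mulrA.
  rewrite (char_idem_geltr (@sgval_morph G N)) -scalerAl coset_coefZ.
  rewrite coset_coef_idem mulr1 mul_charE; congr (_ * _).
  rewrite /coset_coef /tri -/be.
  set m := subg N (sgval n' ^ (tau al)^-1)%g.
  have mE : sgval m = (tau al * sgval n' * (tau al)^-1)%g.
    by rewrite subgK ?conj_in_normal ?subgP // conjgE invgK mulgA.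
  rewrite (bigD1 m) //= [X in _ + X]big1 => [|k km].
    by rewrite ffunE mE !mulgA mulgKV eqxx mulr1 addr0 conj_charE.
  rewrite ffunE; case: eqP => [|_]; last by rewrite mulr0.
  move=> kE; case/eqP: km; apply: val_inj; rewrite /= mE.
  by apply: (mulIg (tau al * g * (tau be)^-1)%g); rewrite kE !mulgA mulgKV.
under eq_bigr => n' _.
  rewrite WE -[_ *: _]/(_ * _) -Defs.charM mulVg Defs.char1.
  over.
by rewrite sumr_const /GRing.scale /= mulVf // card_neq0.
Qed.

Lemma coset_ideal_mul al g h a b :
  coset_ideal al g a -> coset_ideal (cj g^-1%g al) h b ->
  coset_ideal al (g * h)%g (a * b).
Proof.
rewrite /coset_ideal => Ya /(YM Ya).
rewrite -scalerAl -scalerAr scalerA !mulrA -(mulrA (eN al)) gelt_char_idemJ.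
by rewrite conj_charVK mulrA (char_idem_id (@sgval_morph G N)) -mulrA geltM.
Qed.

(** The first element times the antipode of the second is [(a * b) *: eN al], by [antipode_hinv]. *)
Lemma coset_ideal_hinv al g a b :
  coset_ideal al g a -> coset_ideal (hinv al) (tri al g) b -> R (a * b).
Proof.
rewrite /coset_ideal => Ya /YS Yb; apply: (@char_idem_coef_integral al).
suff -> : (a * b) *: eN al = a *: (eN al * gelt K g) *
  antipode H (b *: (eN (hinv al) * gelt K (tri al g))) by apply: YM.
have -> : antipode H (b *: (eN (hinv al) * gelt K (tri al g))) =
    b *: antipode H (eN (hinv al) * gelt K (tri al g)).
  rewrite !antipodeE -[b *: (_ * _)]addr0 antipode_is_linear.
  rewrite (_ : antipode _ 0 = 0) ?addr0; last first.
    by rewrite /= big1 // => h _; rewrite ffunE scale0r.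
  by rewrite -scalerAr -scalerAl.
rewrite antipode_hinv -[RHS]scalerAl -[X in _ = _ *: X]scalerAr [RHS]scalerA.
congr (_ *: _); rewrite mulrA -(mulrA (eN _)) geltV.
by rewrite mulr1 (char_idem_id (@sgval_morph G N)).
Qed.

(** At trivial characters [perm_coef_integral] concerns the sum of all coefficients, which here is
    [c]. *)
Lemma coset_ideal_one g c : coset_ideal 1%g g c -> R c.
Proof.
move=> Yc; have := perm_coef_integral 1%g 1%g Yc.
rewrite sum_coset_restr //.
under eq_bigl do rewrite conj_char_one eqxx.
under eq_bigr do rewrite one_charE.
by rewrite sumr_const mulVf ?mulr1 // card_neq0.
Qed.

(* Membership of 1 in a product of coset ideals is expressed by quantifying over
   the R-submodules Z of K that contain all products of their elements. *)
Definition submod_of_K (Z : K -> Prop) : Prop :=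
  [/\ Z 0, forall a b, Z a -> Z b -> Z (a + b)
    & forall r a, R r -> Z a -> Z (r * a)].

Lemma submod_of_K_scale Z a : submod_of_K Z -> submod_of_K (fun z => Z (a * z)).
Proof.
case=> Z0 ZD ZZ; split=> [|b c Zb Zc|r b Rr Zb].
- by rewrite mulr0.
- by rewrite mulrDr; apply: ZD.
by rewrite mulrCA; apply: ZZ.
Qed.

(** Each use of [coset_ideal_circ] splits off a factor for [al] and replaces [g] by [tri al g]; the
    induction ends at the trivial character, where the ideal lies in R. *)
Lemma coset_ideal_iter al m g c (Z : K -> Prop) :
  coset_ideal (iter m (circ al) 1%g) g c -> submod_of_K Z ->
  (forall d : nat -> K,
     (forall i, (i < m)%N -> coset_ideal al (iter i (tri al) g) (d i)) ->
     Z (\prod_(i < m) d i)) -> Z c.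
Proof.
elim: m g c Z => [|m IHm] g c Z Ic Zsub Zd.
  have [_ _ ZZ] := Zsub; rewrite -[c]mulr1; apply: ZZ.
    exact: coset_ideal_one Ic.
  by have := Zd (fun=> 1); rewrite big_ord0; apply.
have [n [a [b [Ia Ib ->]]]] := coset_ideal_circ Ic.
have [Z0 ZD _] := Zsub; apply: (big_ind Z) => // j _.
apply: (IHm (tri al g) (b j) (fun z => Z (a j * z))) => // [|d Id].
  exact: submod_of_K_scale.
have := Zd (fun i => if i is i'.+1 then d i' else a j).
rewrite big_ord_recl; apply=> -[|i] //= im.
by rewrite -iterS iterSr; apply: Id.
Qed.

(** As the [m]-fold iterate is trivial, [coset_ideal_iter] expands 1 once for each [g] in [s]; these
    expansions are multiplied together. *)
Lemma coset_ideal_orbit_span al m (s : seq G) (Z : K -> Prop) :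
  iter m (circ al) 1%g = 1%g -> uniq s -> submod_of_K Z ->
  (forall d : G -> nat -> K,
     (forall g (k : nat), g \in s -> (k < m)%N ->
        coset_ideal al (iter k (tri al) g) (d g k)) ->
     Z (\prod_(g <- s) \prod_(k < m) d g k)) -> Z 1.
Proof.
move=> al_m; elim: s Z => [|g s IHs] Z /=.
  by move=> _ _ Zd; have := Zd (fun _ _ => 1); rewrite big_nil; apply.
case/andP=> gs s_uniq Zsub Zd.
apply: (@coset_ideal_iter al m g 1 Z) => // [|d Id].
  by rewrite al_m /coset_ideal scale1r; apply: trivial_char_idem_mul_in_order.
rewrite -[\prod_k _]mulr1.
apply: (IHs (fun z => Z (\prod_(k < m) d k * z))) => // [|D ID].
  exact: submod_of_K_scale.
(* As [g] does not recur in [s], the two families glue. *)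
have := Zd (fun h => if h == g then d else D h).
rewrite big_cons eqxx (eq_big_seq (fun h => \prod_(k < m) D h k)) => [|h hs].
  apply=> h k; rewrite inE; case: eqP => [-> _|_] /=; first exact: Id.
  exact: ID.
by case: eqP => // hg; rewrite hg (negbTE gs) in hs.
Qed.

(** The iterates of [tri al] permute G, so for each fixed exponent the product over G can be
    reindexed to remove them. *)
Lemma coset_ideal_span al m (Z : K -> Prop) :
  iter m (circ al) 1%g = 1%g -> submod_of_K Z ->
  (forall d : G -> nat -> K,
     (forall g (k : nat), (k < m)%N -> coset_ideal al g (d g k)) ->
     Z (\prod_g \prod_(k < m) d g k)) -> Z 1.
Proof.
move=> al_m Zsub Zd.
apply: (@coset_ideal_orbit_span al m (index_enum G)) => // [|d Id].
  exact: index_enum_uniq.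
have iter_inj i : injective (iter i (tri al)).
  by elim: i => // i IHi x y /tri_inj/IHi.
pose q i := invF (iter_inj i).
have qK i : cancel (q i) (iter i (tri al)) := f_invF (iter_inj i).
have -> : \prod_g \prod_(i < m) d g i = \prod_g \prod_(i < m) d (q i g) i.
  rewrite exchange_big [RHS]exchange_big; apply: eq_bigr => i _.
  by rewrite (reindex_inj (can_inj (qK i))).
apply: (Zd (fun g i => d (q i g) i)) => g i im.
by have := Id (q i g) i (mem_index_enum _) im; rewrite qK.
Qed.

(** [circ al] is a permutation of a finite set, so the order of the symmetric group is an exponent
    for it. *)
Lemma iter_circ_exponent al :
  iter #|[set: {perm hatN}]| (circ al) 1%g = 1%g.
Proof.
have /(congr1 (fun p : {perm hatN} => p 1%g)) :
    ((perm (@circ_inj al)) ^+ #|[set: {perm hatN}]| = 1)%g.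
  by rewrite expg_cardG ?inE.
rewrite permX perm1 => {2}<-; apply: eq_iter => x.
by rewrite permE.
Qed.

(* c ^+ (#|G| * m) multiplies the product of the ideals I(g^-1 al, h), which
   contains 1, into the product of the ideals I(al, g h); the latter times the
   product of the ideals I(hinv al, h), which also contains 1, lies in R. *)
Lemma coset_ideal_integral al g c : coset_ideal al g c -> R c.
Proof.
move=> Ic; set m := #|[set: {perm hatN}]|.
have m_gt0 : (0 < m)%N by apply: cardG_gt0.
apply: (@ring_of_integers_expr K (#|G| * m)%N).
  by rewrite muln_gt0 m_gt0 andbT -cardsT cardG_gt0.
rewrite -[_ ^+ _]mulr1.
have Rsub : submod_of_K R.
  split; [exact: ring_of_integers0 | exact: ring_of_integersD|].
  exact: ring_of_integersM.
apply: (@coset_ideal_span (cj g^-1%g al) m (fun z => R (c ^+ (#|G| * m) * z))).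
- exact: iter_circ_exponent.
- exact: submod_of_K_scale.
move=> d Id.
pose f h (k : nat) := c * d h k.
have If h (k : nat) : (k < m)%N -> coset_ideal al (g * h)%g (f h k).
  by move=> km; apply: coset_ideal_mul => //; apply: Id.
have -> : c ^+ (#|G| * m) * \prod_h \prod_(k < m) d h k =
    \prod_h \prod_(k < m) f h k.
  rewrite mulnC exprM -prodr_const -big_split; apply: eq_bigr => h _ /=.
  by rewrite big_split prodr_const card_ord.
rewrite -[\prod_h _]mulr1.
apply: (@coset_ideal_span (hinv al) m
  (fun z => R (\prod_h \prod_(k < m) f h k * z))).
- exact: iter_circ_exponent.
- exact: submod_of_K_scale.
move=> d' Id'.
(* Reindexing by this map gives each factor from I(al, g h) the partner required by
   [coset_ideal_hinv]. *)
have tri_gh_inj : injective (fun h => tri al (g * h)%g).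
  by move=> x y /tri_inj/mulgI.
rewrite [X in _ * X](reindex_inj tri_gh_inj) -big_split /=.
apply: ring_of_integers_prod => h _; rewrite -big_split /=.
apply: ring_of_integers_prod => k _.
by apply: (@coset_ideal_hinv al (g * h)%g); [apply: If | apply: Id'].
Qed.

(** 1 lies in the product of I(al, g) and I(hinv al, tri al g), and the second factor is
    integral. *)
Lemma coset_ideal1 al g : coset_ideal al g 1.
Proof.
have I1 : coset_ideal (circ al (hinv al)) g 1.
  rewrite circ_hinv /coset_ideal scale1r.
  exact: trivial_char_idem_mul_in_order.
have [n [a [b [Ia Ib ->]]]] := coset_ideal_circ I1.
rewrite /coset_ideal scaler_suml; apply: (submodule_sum Ysub) => j _.
rewrite mulrC -scalerA; apply: YZ; last exact: Ia.
exact: coset_ideal_integral (Ib j).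
Qed.

Lemma order_eq_idem_order : idem_order R N = Y.
Proof.
apply/seteqP; split=> [x|y Yy].
  apply; first by split.
  move=> _ [nu [g ->]].
  by have := coset_ideal1 nu g; rewrite /coset_ideal scale1r.
move=> X [[X0 XD XZ] _ _] Xgen.
have X_sum (I : finType) (P : pred I) (F : I -> KG) :
    (forall i, P i -> X (F i)) -> X (\sum_(i | P i) F i).
  by move=> XF; elim/big_ind: _.
(* Cutting by idempotents and cosets writes [y] as an integral combination of generators. *)
rewrite -[y]mul1r -(sum_char_idem (@sgval_morph G N) splitN) mulr_suml.
apply: (X_sum) => al _.
rewrite [y](coset_partK N) mulr_sumr; apply: (X_sum) => k _.
rewrite idem_coset_part; apply: XZ.
  by apply: (@coset_ideal_integral al k); apply: coset_ideal_coef.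
by apply: Xgen; exists al, k.
Qed.

End TwistedOrders.

(** * The conditions on the Lagrangian twist, and the equivalence *)

Lemma lagr_dual_ptV (K : fieldExtType rat) (A : finGroupType)
    (splitA : split_galg K A) (omega : chars K A -> chars K A -> K)
    (omegaP : normalized_2cocycle omega) (L : {group chars K A})
    (s : chars K [subg L] -> chars K A)
    (decL : lagrangian_decomposition omega s) (lam : chars K [subg L]) :
  lagr_dual_pt s lam^-1%g 1%g = (lagr_dual_pt s lam 1%g)^-1%g.
Proof.
apply: (char_separate splitA) => phi.
have [[m mu] <-] := lagr_pt_surj omegaP decL phi.
rewrite charVE !(lagr_dual_ptE omegaP decL) inv_charE.
by rewrite !Defs.char1 !mulr1.
Qed.

Section LagrangianTwistConjugation.
Variables (K : fieldExtType rat) (G : finGroupType) (M N : {group G}).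
Hypotheses (splitM : split_galg K [subg M]) (abM : abelian M).
Variable omega : chars K [subg M] -> chars K [subg M] -> K.
Hypothesis omegaP : normalized_2cocycle omega.
Variables (L : {group chars K [subg M]}).
Variable s : chars K [subg L] -> chars K [subg M].
Hypothesis decL : lagrangian_decomposition omega s.
Hypothesis LN : forall l : [subg L], sgval (lagr_emb s l) \in N.
Hypothesis nN : (N <| [set: G])%g.
Local Notation tau := (twist_elt splitM omegaP decL LN).

Lemma twist_eltV al : tau al^-1%g = (tau al)^-1%g.
Proof.
have restrV : char_restr splitM omegaP decL LN al^-1%g =
    (char_restr splitM omegaP decL LN al)^-1%g.
  by apply: char_eqP => l; rewrite !ffunE.
have dualV := lagr_dual_ptV splitM omegaP decL
  (char_restr splitM omegaP decL LN al).
by rewrite /twist_elt restrV dualV.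
Qed.

Lemma twist_elt_conj m al : m \in M -> tau (conj_char nN m al) = tau al.
Proof.
move=> mM.
have restrJ : char_restr splitM omegaP decL LN (conj_char nN m al) =
    char_restr splitM omegaP decL LN al.
  apply: char_eqP => l; rewrite !ffunE; congr (al _); apply: val_inj => /=.
  rewrite !subgK ?conj_in_normal ?LN // conjgE.
  by rewrite (centsP abM _ (subgP (lagr_emb s l)) m mM) mulKg.
by rewrite /twist_elt restrJ.
Qed.

End LagrangianTwistConjugation.

Theorem proposition4p3
  (K : fieldExtType rat) (G : finGroupType) (M N : {group G})
  (* K is large enough *)
  (splitM : split_galg K [subg M]) (splitN : split_galg K [subg N])
  (abM : abelian M) (ctM : central_type M)
  (omega : chars K [subg M] -> chars K [subg M] -> K)
  (omega_cocycle : normalized_2cocycle omega)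
  (omega_nondeg : nondegenerate_cocycle omega)
  (L : {group chars K [subg M]})
  (s : chars K [subg L] -> chars K [subg M])
  (decL : lagrangian_decomposition omega s)
  (omegaE : forall (l l' : [subg L]) (lam lam' : chars K [subg L]),
     omega (lagr_pt s l lam) (lagr_pt s l' lam') = lam l')
  (abN : abelian N) (nN : (N <| [set: G])%g)
  (LN : forall l : [subg L], sgval (lagr_emb s l) \in N)
  (faithN : [faithful ([set: G] / N)%g, on N | ('J %% N)%act])
  (Y : set (galg K G))
  (orderY : hopf_order (@ring_of_integers K) (twisted_hopf omega) Y) :
  [<-> idem_order (@ring_of_integers K) N = Y;
       forall nu : chars K [subg N], Y (char_idem sgval nu);
       Y (char_idem (fun l : [subg L] => sgval (lagr_emb s l)) 1%g) /\
       Y (char_idem sgval (1%g : chars K [subg N]))].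
Proof.
have tau_conj al be :
    twist_elt splitM omega_cocycle decL LN
      (conj_char nN (twist_elt splitM omega_cocycle decL LN al) be) =
    twist_elt splitM omega_cocycle decL LN be.
  by apply: twist_elt_conj => //; apply: twist_elt_in.
have [[Ysub _ _] _] := orderY.
tfae=> [<- nu X _ SX|Ye|[_ Ye1]].
- by apply: SX; exists nu, 1%g; rewrite gelt1 mulr1.
- split; last exact: Ye.
  (* The product of the idempotent of L with each idempotent of N is the latter or zero. *)
  rewrite -[char_idem _ _]mulr1 -(sum_char_idem (@sgval_morph G N) splitN).
  rewrite mulr_sumr; apply: (submodule_sum Ysub) => nu _.
  rewrite (lagr_idem_mull splitM omega_cocycle decL LN).
  case: eqP => _; first by rewrite scale1r.
  by rewrite scale0r; case: Ysub.
apply: (@order_eq_idem_order _ _ _ nN abN splitN faithN _ _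
  (twist_elt splitM omega_cocycle decL LN)) (orderY) _ => //.
- exact: twist_mulr.
- exact: twist_inv_mull.
- exact: twist_U_mull.
- exact: twist_U_inv_mulr.
- exact: twist_elt1.
apply: (@char_idem_in_order _ _ _ nN splitN _ _
  (twist_elt splitM omega_cocycle decL LN)) (orderY) Ye1 => //.
- exact: twist_mull.
- exact: twist_inv_mulr.
- exact: twist_eltV.
Qed.
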